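(* Consider the setting in the context, assume Condition (C1) and $p=o(\min\{\tilde n_r,N_f\})$. There are positive constants $c_1,c_2,c_3$ such that: for any $\lambda^{(\mathrm{diff})}\ge2\Lambda_{\max}(\Sigma_f)/\Lambda_{\min}(\Sigma_r)$, with probability at least $1-\exp\{-c_1p\}$, $$\|\hat{\boldsymbol\theta}_r^{(\mathrm{diff})}-\boldsymbol\theta_r\|_2\le c_2\Big(\sqrt{\tfrac{p}{\tilde n_r}}+\frac{\sqrt{p/N_f}+\delta}{\lambda^{(\mathrm{diff})}}\Big).$$ Hence, if $\lambda^{(\mathrm{diff})}=\max\big\{\sqrt{\tilde\omega_r/\omega_f}+\sqrt{\tilde n_r/p}\,\delta,\ 2\Lambda_{\max}(\Sigma_f)/\Lambda_{\min}(\Sigma_r)\big\}$, then with the same probability $$\|\hat{\boldsymbol\theta}_r^{(\mathrm{diff})}-\boldsymbol\theta_r\|_2\le c_3\sqrt{\tfrac{p}{\tilde n_r}}.$$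
   Context: Remaining data $\mathcal D_r=\{(\boldsymbol x_i^{(r)},y_i^{(r)})\}_{i=1}^{N_r}\subset\mathbb R^p\times\mathbb R$ and forget data $\mathcal D_f=\{(\boldsymbol x_i^{(f)},y_i^{(f)})\}_{i=1}^{N_f}$; all samples independent (not necessarily identically distributed; no linear model assumed). $N=N_r+N_f$, $\omega_f=N_f/N\le c<1$. $\widetilde{\mathcal D}_r\subseteq\mathcal D_r$ random subsample of size $\tilde n_r$, $\tilde\omega_r=\tilde n_r/N_r$. Design matrices $X^{(r)}$, $X^{(f)}$; $\widehat\Sigma_r=(X^{(r)})^\top X^{(r)}/N_r$, $\widehat\Sigma_f=(X^{(f)})^\top X^{(f)}/N_f$. Squared loss $\ell(\boldsymbol\theta;\mathcal D')=\sum_{(\boldsymbol x,y)\in\mathcal D'}(y-\boldsymbol x^\top\boldsymbol\theta)^2$; $\boldsymbol\theta_r=\arg\min\mathbb E[\ell(\boldsymbol\theta;\mathcal D_r)]$, $\boldsymbol\theta_f=\arg\min\mathbb E[\ell(\boldsymbol\theta;\mathcal D_f)]$, $\delta=\|\boldsymbol\theta_r-\boldsymbol\theta_f\|_2$. GradDiff estimator: $$\hat{\boldsymbol\theta}_r^{(\mathrm{diff})}=\arg\min_{\boldsymbol\theta\in\mathbb R^p}\Big\{-\frac1{N_f}\ell(\boldsymbol\theta;\mathcal D_f)+\frac{\lambda^{(\mathrm{diff})}}{\tilde n_r}\ell(\boldsymbol\theta;\widetilde{\mathcal D}_r)\Big\},\ \lambda^{(\mathrm{diff})}>0.$$ Condition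 (C1): $((\boldsymbol x_i^{(r)})^\top,y_i^{(r)})$ independent sub-Gaussian, $\mathbb E[\widehat\Sigma_r]=\Sigma_r$, $c_\Sigma^{-1}\le\Lambda_{\min}(\Sigma_r)\le\Lambda_{\max}(\Sigma_r)\le c_\Sigma$ ($c_\Sigma>1$ constant); $((\boldsymbol x_i^{(f)})^\top,y_i^{(f)})$ independent mean-zero sub-Gaussian, $\mathbb E[\widehat\Sigma_f]=\Sigma_f$ with the same eigenvalue bounds. *)

(* Defs.v *)
From HB Require Import structures.
From mathcomp Require Import all_boot all_order all_algebra.
From mathcomp Require Import all_classical all_reals all_analysis.
Set Implicit Arguments.
Unset Strict Implicit.
Unset Printing Implicit Defensive.
Import Order.TTheory GRing.Theory Num.Theory.
Import numFieldNormedType.Exports.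
Local Open Scope classical_set_scope.
Local Open Scope ring_scope.

Section Defs.
Context {R : realType}.

(** A data point (x, y) in R^p x R is stored as a (p+1)-tuple whose first
    p coordinates form x and whose last coordinate is y. *)
Definition xpart {p : nat} (z : p.+1.-tuple R) : 'rV[R]_p :=
  \row_(j < p) tnth z (widen_ord (leqnSn p) j).
Definition ypart {p : nat} (z : p.+1.-tuple R) : R := tnth z ord_max.

Definition dotv {p : nat} (u v : 'rV[R]_p) : R := \sum_(j < p) u 0 j * v 0 j.
Definition norm2 {p : nat} (v : 'rV[R]_p) : R := Num.sqrt (dotv v v).

Definition sqloss {p : nat} (theta : 'rV[R]_p) (z : p.+1.-tuple R) : R :=
  (ypart z - dotv (xpart z) theta) ^+ 2.

Definition lambda_max {p : nat} (A : 'M[R]_p) : R := sup [set a | eigenvalue A a].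
Definition lambda_min {p : nat} (A : 'M[R]_p) : R := inf [set a | eigenvalue A a].

Context {d : measure_display} {Omega : measurableType d}.

Definition mutually_independent (P : probability Omega R) (I : finType)
  (E : I -> set (set Omega)) : Prop :=
  forall (J : {set I}) (A : I -> set Omega),
    (forall i, i \in J -> E i (A i)) ->
    P (\bigcap_(i in [set i | i \in J]) A i) = (\prod_(i in J) P (A i))%E.

Definition gen_events {d' : measure_display} {T : measurableType d'}
  (X : Omega -> T) : set (set Omega) :=
  [set X @^-1` B | B in [set B : set T | measurable B]].

Definition gen_events_discrete {T : Type} (X : Omega -> T) : set (set Omega) :=
  [set X @^-1` B | B in [set: set T]].

(** sub-Gaussian random vector with psi_2-norm at most K:
    E[exp((u^T z)^2 / K^2)] <= 2 for every unit vector u *)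
Definition subgaussian_vec (P : probability Omega R) {n : nat}
  (Z : Omega -> n.-tuple R) (K : R) : Prop :=
  forall u : n.-tuple R, \sum_(k < n) tnth u k ^+ 2 = 1 ->
    ('E_P[fun w => expR ((\sum_(k < n) tnth u k * tnth (Z w) k) ^+ 2 / K ^+ 2)]
       <= 2%:E)%E.

Definition pop_cov (P : probability Omega R) {p N : nat}
  (Z : 'I_N -> Omega -> p.+1.-tuple R) : 'M[R]_p :=
  \matrix_(j < p, k < p)
    (N%:R^-1 * \sum_(i < N) fine 'E_P[fun w => xpart (Z i w) 0 j * xpart (Z i w) 0 k]).

Definition pop_loss (P : probability Omega R) {p N : nat}
  (Z : 'I_N -> Omega -> p.+1.-tuple R) (theta : 'rV[R]_p) : \bar R :=
  (\sum_(i < N) 'E_P[fun w => sqloss theta (Z i w)])%E.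

Definition graddiff_obj {p Nr Nf : nat} (lam : R) (ntr : nat)
  (Zr : 'I_Nr -> Omega -> p.+1.-tuple R) (Zf : 'I_Nf -> Omega -> p.+1.-tuple R)
  (S : Omega -> {set 'I_Nr}) (w : Omega) (theta : 'rV[R]_p) : R :=
  - (Nf%:R^-1 * \sum_(i < Nf) sqloss theta (Zf i w))
  + lam / ntr%:R * \sum_(i in S w) sqloss theta (Zr i w).

Definition is_argmin {p : nat} (f : 'rV[R]_p -> R) (t : 'rV[R]_p) : Prop :=
  forall theta, f t <= f theta.

End Defs.

(* Main.v *)
(** Put [f] for the GradDiff objective and [h = th - theta_r]. It is quadratic,
    [f (theta_r + h) = f theta_r + h H h - 2 g.h] with [H = lam * G_r - G_f] and
    [g = lam * g_r - g_f], where [G] denotes the empirical second-moment matrices and [g] the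
    empirical scores at [theta_r]. As [lam >= 2 lambda_max / lambda_min], [H >= lam * m]
    as soon as [G_r] and [G_f] are within a small constant of their means; then a minimizer
    exists and [f th <= f theta_r] yields [|h| <= 2 |g| / (lam * m)]. The population scores at
    [theta_r] and [theta_f] vanish, hence
    [|g| <= C (lam * sqrt (p / ntr) + sqrt (p / Nf) + delta)].

    All deviations are sums of products of two sub-Gaussian linear forms, controlled by
    Chernoff bounds over a [1/4]-net of the unit ball of cardinality at most [2 ^ (18 p)].
    For the uniformly random subset, the moment generating function of the sum is an
    elementary symmetric mean of the individual ones, and Maclaurin's inequality bounds it by
    the power of their average: no conditioning on the subset is needed although the samples
    are not identically distributed. *)
Require Import Defs.
From HB Require Import structures.
From mathcomp Require Import all_boot all_order all_algebra.
From mathcomp Require Import all_classical all_reals all_analysis.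
From mathcomp Require Import measurable_realfun ring lra zify finmap.
Set Implicit Arguments.
Unset Strict Implicit.
Unset Printing Implicit Defensive.
Import Order.TTheory GRing.Theory Num.Theory.
Import numFieldNormedType.Exports.
Local Open Scope classical_set_scope.
Local Open Scope ring_scope.

(** * Maclaurin's inequality *)

(** The constants may depend only on [K] and [cS], while no bound on [theta_r] or [theta_f] is
    assumed. Comparing the population loss at a minimizer with the loss at [0] bounds these vectors,
    so the residuals are sub-Gaussian with a uniform constant.

    The forget score has mean zero at [theta_f], not at [theta_r]. Moving it to [theta_r] costs
    [G_f] applied to the difference, and this is where [delta] enters.

    Conditionally on the subset, an empirical average is centred at the mean of the chosen points,
    not at the population mean. Maclaurin's inequality restores the right centre.

    Only the two samples are controlled in probability. The weight [lam] enters deterministically,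
    so one event serves all admissible [lam]. *)

Lemma reindex_add_elt (R : nmodType) (T : finType) (k : nat)
    (g : {set T} -> T -> R) :
  \sum_(B : {set T} | #|B| == k.+1) \sum_(i in B) g (B :\ i)%SET i =
  \sum_(C : {set T} | #|C| == k) \sum_(i in ~: C) g C i.
Proof.
rewrite pair_big_dep [RHS]pair_big_dep /=.
(* Pairs [(B, i)] with [i] in [B] correspond to pairs [(C, i)] with [i] outside [C = B :\ i]. *)
rewrite (reindex_onto (fun x : {set T} * T => ((x.2 |: x.1)%SET, x.2))
  (fun x : {set T} * T => ((x.1 :\ x.2)%SET, x.2))) /=; last first.
  by move=> [B i] /= /andP[_ iB]; rewrite finset.setD1K.
apply: eq_big => [[C i] | [C i]] /=; last first.
  by move=> /andP[_ /eqP[->]].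
rewrite finset.in_setC finset.setU11 andbT cardsU1.
case: (boolP (i \in C)) => iC /=.
  rewrite andbF add0n andbC; apply/negbTE; apply/nandP; left.
  apply/negP => /eqP[] /setP/(_ i); rewrite !inE eqxx /= => /esym.
  by rewrite iC.
rewrite andbT add1n eqSS; case: eqP => //= _.
by rewrite finset.setU1K // eqxx.
Qed.

(** Symmetrizing in [i] and [j] turns twice the sum into a sum of squares [(m i - m j) ^+ 2]. *)
Lemma sum_mul_sub_ge0 (R : realFieldType) (T : finType) (D : {set T}) (m : T -> R) :
  0 <= \sum_(i in D) \sum_(j in D) m i * (m i - m j).
Proof.
rewrite -(pmulrn_lge0 _ (ltn0Sn 1)) mulr2n {2}exchange_big /= -big_split /=.
apply: sumr_ge0 => i _; rewrite -big_split /=; apply: sumr_ge0 => j _.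
rewrite (_ : _ + _ = (m i - m j) ^+ 2) ?sqr_ge0 //; ring.
Qed.

(** After division of [e_k] by ['C(N, k)], raising [k] by one multiplies the elementary symmetric
    mean by at most the average of [m]. This is the inductive step of [maclaurin]. *)
Lemma elem_sym_step (R : realFieldType) (N k : nat) (m : 'I_N -> R) :
  (forall i, 0 <= m i) ->
  N%:R * k.+1%:R * (\sum_(A : {set 'I_N} | #|A| == k.+1) \prod_(i in A) m i) <=
  (N - k)%:R * (\sum_(A : {set 'I_N} | #|A| == k) \prod_(i in A) m i) *
    \sum_i m i.
Proof.
move=> m0; set e := fun k => \sum_(A : {set 'I_N} | #|A| == k) \prod_(i in A) m i.
have eS l : l.+1%:R * e l.+1 =
    \sum_(C : {set 'I_N} | #|C| == l) \sum_(i in ~: C) (\prod_(j in C) m j) * m i.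
  rewrite -(@reindex_add_elt _ _ _ (fun C i => (\prod_(j in C) m j) * m i)).
  rewrite /e mulr_sumr; apply: eq_bigr => B /eqP cB.
  rewrite -cB mulr_natl -sumr_const; apply: eq_bigr => i iB.
  by rewrite (big_setD1 i iB) /= mulrC.
(* [(k+1) e_(k+1)] falls short of [e_k e_1] by the double sum below *)
suff key : k%:R * e k * \sum_i m i <= N%:R *
    \sum_(B : {set 'I_N} | #|B| == k) \sum_(i in B) (\prod_(j in B) m j) * m i.
  (* If [N < k], no subset has [k.+1] elements and the truncated [N - k] is [0]. *)
  case: (leqP k N) => [kN|Nk]; last first.
    rewrite (_ : \sum_(A : {set 'I_N} | #|A| == k.+1) _ = 0); last first.
      rewrite big_pred0 // => A; apply/negbTE; rewrite neq_ltn ltnS.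
      by rewrite (leq_trans (max_card _)) // card_ord ltnW.
    rewrite mulr0 !mulr_ge0 // ?sumr_ge0 // => A _; exact: prodr_ge0.
  rewrite natrB // -/(e k) -/(e k.+1) -mulrA eS.
  have -> : \sum_(C : {set 'I_N} | #|C| == k) \sum_(i in ~: C) (\prod_(j in C) m j) * m i
     = e k * (\sum_i m i) -
     \sum_(B : {set 'I_N} | #|B| == k) \sum_(i in B) (\prod_(j in B) m j) * m i.
    rewrite /e mulr_suml -sumrB; apply: eq_bigr => C _.
    rewrite -!mulr_sumr -mulrBr; congr (_ * _).
    rewrite [X in _ = X - _](bigID (mem C)) /= addrAC subrr add0r.
    by apply: eq_bigl => i; rewrite finset.in_setC.
  rewrite mulrBr !mulrBl mulrA lerB //.
rewrite -subr_ge0.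
have -> : N%:R * \sum_(B : {set 'I_N} | #|B| == k) \sum_(i in B) (\prod_(j in B) m j) * m i
   - k%:R * e k * (\sum_i m i) =
   \sum_(B : {set 'I_N} | #|B| == k) \sum_(i in B) (\prod_(j in B) m j) *
      \sum_(j in ~: B) (m i - m j).
  rewrite -mulrA mulr_sumr {1}/e mulr_suml mulr_sumr -sumrB.
  apply: eq_bigr => B /eqP cB.
  rewrite -!mulr_sumr (mulrCA N%:R) (mulrCA k%:R) -mulrBr; congr (_ * _).
  have -> : N%:R * (\sum_(i in B) m i) - k%:R * (\sum_i m i)
     = \sum_(i in B) \sum_j (m i - m j).
    under [RHS]eq_bigr do rewrite sumrB sumr_const card_ord.
    by rewrite sumrB sumr_const cB sumrMnl !mulr_natl.
  (* Pairs inside [B] cancel by antisymmetry; only [j] outside [B] remains. *)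
  transitivity (\sum_(i in B) (\sum_(j in B) (m i - m j)
      + \sum_(j in ~: B) (m i - m j))).
    apply: eq_bigr => i iB; rewrite (bigID (mem B)) /=; congr (_ + _).
    by apply: eq_bigl => j; rewrite finset.in_setC.
  rewrite big_split /= [X in X + _](_ : _ = 0) ?add0r //.
  under eq_bigr do rewrite sumrB.
  by rewrite sumrB exchange_big /= subrr.
case: k => [|k].
  apply: sumr_ge0 => B; rewrite cards_eq0 => /eqP ->.
  by rewrite big1 // => i; rewrite finset.in_set0.
(* Writing [B = i |: C] extracts the factor [m i]. For fixed [C] this leaves the sum of
   [sum_mul_sub_ge0] over the complement of [C], since the missing terms [j = i] vanish. *)
have -> : \sum_(B : {set 'I_N} | #|B| == k.+1) \sum_(i in B) (\prod_(j in B) m j) *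
      \sum_(j in ~: B) (m i - m j) =
  \sum_(C : {set 'I_N} | #|C| == k) \sum_(i in ~: C) ((\prod_(j in C) m j) * m i) *
      \sum_(j in ~: (i |: C)) (m i - m j).
  rewrite -(@reindex_add_elt _ _ _ (fun C i => (\prod_(j in C) m j) * m i *
      \sum_(j in ~: (i |: C)) (m i - m j))).
  apply: eq_bigr => B _; apply: eq_bigr => i iB.
  by rewrite finset.setD1K // (big_setD1 i iB) /= (mulrC (m i)).
apply: sumr_ge0 => C _.
have := sum_mul_sub_ge0 (~: C) m.
have : 0 <= \prod_(j in C) m j by exact: prodr_ge0.
move=> /mulr_ge0 /[apply]; congr (0 <= _); rewrite mulr_sumr.
apply: eq_bigr => i iC; rewrite -mulr_sumr mulrA; congr (_ * _).
rewrite (big_setD1 i iC) /= subrr add0r; apply: eq_bigl => j.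
by rewrite !inE negb_or.
Qed.

(* The case [n = N] is the AM-GM inequality. *)
Lemma maclaurin (R : realFieldType) (N n : nat) (m : 'I_N -> R) :
  (forall i, 0 <= m i) -> (n <= N)%N ->
  \sum_(A : {set 'I_N} | #|A| == n) \prod_(i in A) m i <=
  'C(N, n)%:R * (N%:R^-1 * \sum_i m i) ^+ n.
Proof.
move=> m0; elim: n => [_|n IH nN].
  rewrite bin0 expr0 mulr1 (big_pred1 finset.set0) ?big_set0 //.
  by move=> A; rewrite cards_eq0.
have Npos : 0 < N%:R :> R by rewrite ltr0n (leq_trans _ nN).
rewrite -(ler_pM2l Npos) -(ler_pM2l (ltr0Sn R n)) mulrA (mulrC n.+1%:R).
apply: le_trans (elem_sym_step n m0) _.
set s := \sum_i m i; have s0 : 0 <= s by exact: sumr_ge0.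
have -> : n.+1%:R * (N%:R * ('C(N, n.+1)%:R * (N%:R^-1 * s) ^+ n.+1)) =
   (N - n)%:R * ('C(N, n)%:R * (N%:R^-1 * s) ^+ n) * s.
  have b : n.+1%:R * 'C(N, n.+1)%:R = (N - n)%:R * 'C(N, n)%:R :> R.
    by rewrite -!natrM mul_bin_left.
  rewrite exprS; transitivity (n.+1%:R * 'C(N, n.+1)%:R * (N%:R^-1 * s) ^+ n * s).
    by field; rewrite gt_eqF.
  by rewrite b -!mulrA.
by rewrite ler_wpM2r // ler_wpM2l // IH // ltnW.
Qed.

(** * Quadratic forms and nets *)

Section EuclideanSpace.
Context {R : realType}.

(** For [0 <= x], multiply [expR x * (1 - x) <= 1] by [1 + x]. For [x < 0], divide it by [1 - x] and
    use [(1 - x) * (1 + x + x ^+ 2) = 1 - x ^+ 3 >= 1]. *)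
Lemma expR_le_quadratic (x : R) : expR x <= 1 + x + x ^+ 2 * expR `|x|.
Proof.
have h : expR x * (1 - x) <= 1.
  rewrite -[leRHS](expRxMexpNx_1 x) ler_wpM2l ?expR_ge0 //.
  exact: expR_ge1Dx.
have [x0|x0] := leP 0 x.
  have : (1 + x) * (expR x * (1 - x)) <= (1 + x) * 1 by rewrite ler_wpM2l // addr_ge0.
  rewrite ger0_norm //; lra.
have : 1 + x + x ^+ 2 <= 1 + x + x ^+ 2 * expR `|x|.
  rewrite lerD2l ler_peMr ?sqr_ge0 // -[leLHS]expR0 ler_expR normr_ge0 //.
apply: le_trans.
have x1 : 0 < 1 - x by lra.
rewrite -(ler_pM2r x1); apply: le_trans h _; nra.
Qed.

(** Common source of both Cauchy-Schwarz inequalities and, with [a = 0], of the vanishing population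
    gradient. *)
Lemma quadratic_disc (a b c : R) :
  (forall t, 0 <= a - 2 * t * b + t ^+ 2 * c) -> 0 <= a -> 0 <= c -> b ^+ 2 <= a * c.
Proof.
move=> h a0 c0; have [c1|c1] := eqVneq c 0.
  have [->|b1] := eqVneq b 0; first by rewrite expr0n /= mulr_ge0.
  (* With [c = 0] the expression is affine in [t], and here it equals [-1]. *)
  have := h ((a + 1) / (2 * b)).
  rewrite c1 mulr0 addr0 (_ : 2 * ((a + 1) / (2 * b)) * b = a + 1); last by field.
  by lra.
have := h (b / c).
rewrite (_ : a - 2 * (b / c) * b + (b / c) ^+ 2 * c = (a * c - b ^+ 2) / c); last by field.
have cp : 0 < c by rewrite lt_neqAle eq_sym c1.
by rewrite pmulr_lge0 ?invr_gt0 // subr_ge0.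
Qed.

Context {p : nat}.
Implicit Types (u v w : 'rV[R]_p) (A : 'M[R]_p).

Lemma dotvC u v : dotv u v = dotv v u.
Proof. by apply: eq_bigr => j _; rewrite mulrC. Qed.

Lemma dotvDl u v w : dotv (u + v) w = dotv u w + dotv v w.
Proof. by rewrite -big_split; apply: eq_bigr => j _; rewrite mxE mulrDl. Qed.

Lemma dotvZl a u w : dotv (a *: u) w = a * dotv u w.
Proof. by rewrite mulr_sumr; apply: eq_bigr => j _; rewrite mxE mulrA. Qed.

Lemma dotvNl u w : dotv (- u) w = - dotv u w.
Proof. by rewrite -scaleN1r dotvZl mulN1r. Qed.

Lemma dotvBl u v w : dotv (u - v) w = dotv u w - dotv v w.
Proof. by rewrite dotvDl dotvNl. Qed.

Lemma dotv0l w : dotv 0 w = 0.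
Proof. by rewrite -(subrr 0) dotvBl subrr. Qed.

Lemma dotvDr u v w : dotv w (u + v) = dotv w u + dotv w v.
Proof. by rewrite ![dotv w _]dotvC dotvDl. Qed.

Lemma dotvZr a u w : dotv w (a *: u) = a * dotv w u.
Proof. by rewrite ![dotv w _]dotvC dotvZl. Qed.

Lemma dotvNr u w : dotv w (- u) = - dotv w u.
Proof. by rewrite ![dotv w _]dotvC dotvNl. Qed.

Lemma dotvBr u v w : dotv w (u - v) = dotv w u - dotv w v.
Proof. by rewrite ![dotv w _]dotvC dotvBl. Qed.

Lemma dotv_sumr (I : finType) (P : pred I) (F : I -> 'rV[R]_p) w :
  dotv w (\sum_(i | P i) F i) = \sum_(i | P i) dotv w (F i).
Proof.
rewrite /dotv exchange_big /=; apply: eq_bigr => j _.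
by rewrite summxE mulr_sumr.
Qed.

Lemma dotv_ge0 u : 0 <= dotv u u.
Proof. by apply: sumr_ge0 => j _; rewrite -expr2 sqr_ge0. Qed.

Lemma dotv_eq0 u : dotv u u = 0 -> u = 0.
Proof.
move=> /eqP; rewrite psumr_eq0 => [/allP h|j _]; last by rewrite -expr2 sqr_ge0.
apply/rowP => j; rewrite mxE; apply/eqP.
by have := h j (mem_index_enum j); rewrite /= mulf_eq0 orbb.
Qed.

Lemma norm2_ge0 u : 0 <= norm2 u.
Proof. exact: sqrtr_ge0. Qed.

Lemma norm2_sqr u : norm2 u ^+ 2 = dotv u u.
Proof. by rewrite sqr_sqrtr // dotv_ge0. Qed.

Lemma norm2_eq0 u : norm2 u = 0 -> u = 0.
Proof. by move=> h; apply: dotv_eq0; rewrite -norm2_sqr h expr0n. Qed.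

Lemma norm2_le u (a : R) : 0 <= a -> dotv u u <= a ^+ 2 -> norm2 u <= a.
Proof. by move=> a0; rewrite -norm2_sqr ler_pXn2r // nnegrE norm2_ge0. Qed.

Lemma dotv_norm2_le u v : dotv u v <= norm2 u * norm2 v.
Proof.
have : dotv u v ^+ 2 <= dotv u u * dotv v v.
  apply: quadratic_disc; rewrite ?dotv_ge0 // => t.
  have := dotv_ge0 (u - t *: v).
  rewrite dotvBl !dotvBr !dotvZl !dotvZr (dotvC v u); congr (0 <= _); ring.
rewrite -!norm2_sqr -exprMn => h; apply: le_trans (ler_norm _) _.
by rewrite -(ler_pXn2r (ltn0Sn 1)) ?nnegrE ?mulr_ge0 ?norm2_ge0 // real_normK ?num_real.
Qed.

Lemma norm2D u v : norm2 (u + v) <= norm2 u + norm2 v.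
Proof.
apply: norm2_le; first by rewrite addr_ge0 ?norm2_ge0.
have := dotv_norm2_le u v.
by rewrite dotvDl !dotvDr (dotvC v u) -!norm2_sqr => ?; lra.
Qed.

Lemma norm2Z a u : norm2 (a *: u) = `|a| * norm2 u.
Proof.
by rewrite /norm2 dotvZl dotvZr mulrA -expr2 sqrtrM ?sqr_ge0 // sqrtr_sqr.
Qed.

Lemma norm2N u : norm2 (- u) = norm2 u.
Proof. by rewrite /norm2 dotvNl dotvNr opprK. Qed.

Lemma norm20 : norm2 (0 : 'rV[R]_p) = 0.
Proof. by rewrite -(scale0r 0) norm2Z normr0 mul0r. Qed.

Definition bform A u v : R := dotv (u *m A) v.

Lemma bformDl A u v w : bform A (u + v) w = bform A u w + bform A v w.
Proof. by rewrite /bform mulmxDl dotvDl. Qed.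

Lemma bformBl A u v w : bform A (u - v) w = bform A u w - bform A v w.
Proof. by rewrite /bform mulmxBl dotvBl. Qed.

Lemma bformZl A a v w : bform A (a *: v) w = a * bform A v w.
Proof. by rewrite /bform -scalemxAl dotvZl. Qed.

Lemma bform0l A w : bform A 0 w = 0.
Proof. by rewrite /bform mul0mx dotv0l. Qed.

Lemma bformDr A u v w : bform A w (u + v) = bform A w u + bform A w v.
Proof. exact: dotvDr. Qed.

Lemma bformBr A u v w : bform A w (u - v) = bform A w u - bform A w v.
Proof. exact: dotvBr. Qed.

Lemma bformZr A a v w : bform A w (a *: v) = a * bform A w v.
Proof. exact: dotvZr. Qed.

Lemma bformE A u v : bform A u v = \sum_i \sum_j A i j * u 0 i * v 0 j.
Proof.
rewrite exchange_big /=; apply: eq_bigr => j _; rewrite mxE mulr_suml.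
by apply: eq_bigr => i _; ring.
Qed.

Lemma bform_mxB A A' u v : bform (A - A') u v = bform A u v - bform A' u v.
Proof. by rewrite /bform mulmxBr dotvBl. Qed.

Lemma bform_mxZ a A u v : bform (a *: A) u v = a * bform A u v.
Proof. by rewrite /bform -scalemxAr dotvZl. Qed.

Lemma bform_scalar a u v : bform a%:M u v = a * dotv u v.
Proof. by rewrite /bform mul_mx_scalar dotvZl. Qed.

Lemma bformC A u v : A^T = A -> bform A u v = bform A v u.
Proof.
move=> sA; rewrite !bformE exchange_big /=; apply: eq_bigr => i _.
by apply: eq_bigr => j _; rewrite -{1}sA mxE mulrAC.
Qed.

(** The size of [C] never matters: it makes suprema of quadratic forms finite, and its positivity
    allows [C^-1] as a coercivity constant. *)
Lemma bform_bounded A : exists2 C, 0 < C & forall u v, `|bform A u v| <= C * (norm2 u * norm2 v).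
Proof.
have coord w i : `|w 0 i| <= norm2 w.
  rewrite -(ler_pXn2r (ltn0Sn 1)) ?nnegrE ?norm2_ge0 // norm2_sqr.
  rewrite real_normK ?num_real // /dotv (bigD1 i) //= -expr2 lerDl.
  by apply: sumr_ge0 => j _; rewrite -expr2 sqr_ge0.
exists (1 + \sum_i \sum_j `|A i j|) => [|u v].
  by apply: ltr_pwDl => //; apply: sumr_ge0 => i _; apply: sumr_ge0.
rewrite bformE mulrDl mul1r; apply: le_trans (_ : (\sum_i \sum_j `|A i j|) * (norm2 u * norm2 v) <= _).
  rewrite mulr_suml; apply: le_trans (ler_norm_sum _ _ _) _; apply: ler_sum => i _.
  rewrite mulr_suml; apply: le_trans (ler_norm_sum _ _ _) _; apply: ler_sum => j _.
  by rewrite !normrM -mulrA ler_wpM2l // ler_pM.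
by rewrite lerDr mulr_ge0 ?norm2_ge0.
Qed.

Lemma bform_CauchySchwarz A u v : A^T = A -> (forall w, 0 <= bform A w w) ->
  bform A u v ^+ 2 <= bform A u u * bform A v v.
Proof.
move=> sA A0; apply: quadratic_disc => // t.
have := A0 (u - t *: v).
rewrite bformBl !bformBr !bformZl !bformZr (bformC v u sA); congr (0 <= _); ring.
Qed.

Lemma normalize u : u != 0 -> dotv ((norm2 u)^-1 *: u) ((norm2 u)^-1 *: u) = 1.
Proof.
move=> u0; rewrite dotvZl dotvZr -norm2_sqr mulrA -expr2 -exprMn mulVf ?expr1n //.
by apply: contraNneq u0 => /norm2_eq0 ->.
Qed.

End EuclideanSpace.

Section Nets.
Context {R : realType}.

(* The net consists of the lattice vectors [k / (4 sqrt p)] of the unit ball; as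
   [|k_j| <= k_j ^ 2], their coordinates satisfy [sum |k_j| <= 16 p]. *)
Lemma quarter_net (p : nat) : (0 < p)%N ->
  exists s : seq 'rV[R]_p,
    [/\ (size s <= 2 ^ (18 * p))%N, (forall v, v \in s -> norm2 v <= 1) &
      forall u, norm2 u <= 1 -> exists2 v, v \in s & norm2 (u - v) <= 4^-1].
Proof.
move=> p0; set M := (16 * p)%N.
have sp0 : 0 < Num.sqrt p%:R :> R by rewrite sqrtr_gt0 ltr0n.
have spE : Num.sqrt p%:R ^+ 2 = p%:R :> R by rewrite sqr_sqrtr // ler0n.
(* A rounding error of at most [h] per coordinate has norm at most [Num.sqrt p%:R * h = 1/4]. *)
pose h : R := (4 * Num.sqrt p%:R)^-1.
have h0 : 0 < h by rewrite invr_gt0 mulr_gt0.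
have h2 : p%:R * h ^+ 2 = 16^-1.
  by rewrite /h exprVn exprMn spE; field; rewrite gt_eqF // ltr0n.
pose vec (x : p.-tuple 'I_M.+1 * p.-tuple bool) : 'rV[R]_p :=
  \row_j ((-1) ^+ tnth x.2 j * (tnth x.1 j : nat)%:R * h).
pose T1 := [set t : p.-tuple 'I_M.+1 | (\sum_(i <- t) i <= M)%N]%SET.
exists [seq v <- [seq vec x | x in finset.setX T1 [set: p.-tuple bool]%SET] | norm2 v <= 1].
split.
- rewrite size_filter (leq_trans (count_size _ _)) // size_map -cardE cardsX.
  (* There are ['C(p + M, p) <= 2 ^ (p + M)] choices of absolute values and [2 ^ p] choices of
     signs. *)
  rewrite card_partial_ord_partitions cardsT card_tuple card_bool.
  have -> : (18 * p = (p + M) + p)%N by rewrite /M; lia.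
  rewrite expnD leq_mul2r; apply/orP; right.
  rewrite -[X in (X ^ _)%N]/(1 + 1)%N expnDn.
  have lt : (p < (p + M).+1)%N by lia.
  by rewrite (bigD1 (Ordinal lt)) //= !exp1n !muln1; exact: leq_addr.
- by move=> v; rewrite mem_filter => /andP[].
move=> u u1.
(* Rounding towards zero keeps each coordinate no larger than that of [u], so the lattice point
   stays in the unit ball. *)
pose k j := Num.truncn (`|u 0 j| / h).
have kle j : (k j)%:R * h <= `|u 0 j|.
  rewrite -ler_pdivlMr //; have /truncn_itv/andP[] // : 0 <= `|u 0 j| / h.
  by rewrite divr_ge0 // ltW.
have klt j : `|u 0 j| < ((k j).+1)%:R * h.
  rewrite -ltr_pdivrMr //; have /truncn_itv/andP[] // : 0 <= `|u 0 j| / h.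
  by rewrite divr_ge0 // ltW.
have ksum : (\sum_j k j <= M)%N.
  rewrite -(ler_nat R) natr_sum.
  apply: le_trans (_ : \sum_j (u 0 j * u 0 j) / h ^+ 2 <= _).
    apply: ler_sum => j _; rewrite ler_pdivlMr ?exprn_gt0 //.
    apply: le_trans (_ : ((k j)%:R * h) ^+ 2 <= _).
      rewrite exprMn ler_wpM2r ?sqr_ge0 // -natrX ler_nat.
      by rewrite expnS expn1; case: (k j) => // m; rewrite leq_pmulr.
    by rewrite -expr2 -(real_normK (num_real (u 0 j))) ler_pXn2r ?nnegrE // mulr_ge0 // ltW.
  rewrite -mulr_suml -/(dotv u u) -norm2_sqr ler_pdivrMr ?exprn_gt0 //.
  rewrite /M natrM -mulrA h2; have : norm2 u ^+ 2 <= 1 by rewrite expr_le1 // norm2_ge0.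
  by lra.
have kM j : (k j < M.+1)%N.
  by rewrite ltnS (leq_trans _ ksum) // (bigD1 j) //= leq_addr.
pose x := ([tuple (Ordinal (kM j)) | j < p], [tuple (u 0 j < 0) | j < p]).
have vecE j : vec x 0 j = (-1) ^+ (u 0 j < 0)%R * (k j)%:R * h.
  by rewrite mxE /= !tnth_mktuple.
have abs j : u 0 j = (-1) ^+ (u 0 j < 0)%R * `|u 0 j|.
  by rewrite {1}[u 0 j]realEsign ?num_real.
exists (vec x).
  rewrite mem_filter; apply/andP; split.
    apply: norm2_le => //; rewrite expr1n.
    have : dotv u u <= 1 by rewrite -norm2_sqr expr_le1 // norm2_ge0.
    apply: le_trans; apply: ler_sum => j _; rewrite vecE {3 4}abs -!expr2 !exprMn.
    rewrite -mulrA ler_wpM2l ?sqr_ge0 // -exprMn ler_pXn2r ?nnegrE // mulr_ge0 // ltW //.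
  apply/mapP; exists x => //; rewrite mem_enum !inE andbT /=.
  by rewrite big_map big_enum.
apply: norm2_le => //.
apply: le_trans (_ : \sum_(j < p) h ^+ 2 <= _); last first.
  by rewrite sumr_const card_ord -[_ *+ p]mulr_natl h2; lra.
apply: ler_sum => j _; rewrite !mxE /= !tnth_mktuple /= {1 3}abs -mulrA -mulrBr -expr2.
rewrite exprMn sqrr_sign mul1r ler_pXn2r ?nnegrE ?subr_ge0 // ?ltW //.
by have := klt j; rewrite -natr1; lra.
Qed.

Variable p : nat.
Implicit Types (u v w : 'rV[R]_p) (A : 'M[R]_p).

(** A net point [v] near [g / |g|] gives [|g| <= dotv v g + |g| / 4], and the last term is
    absorbed. *)
Lemma norm2_le_net (s : seq 'rV[R]_p) (g : 'rV[R]_p) (t : R) :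
  (forall u, norm2 u <= 1 -> exists2 v, v \in s & norm2 (u - v) <= 4^-1) ->
  (forall v, v \in s -> dotv v g <= t) -> 0 <= t -> norm2 g <= 2 * t.
Proof.
move=> net gt t0; have [g0|g0] := eqVneq (norm2 g) 0; first by rewrite g0; lra.
have gp : 0 < norm2 g by rewrite lt_neqAle eq_sym g0 norm2_ge0.
pose u := (norm2 g)^-1 *: g.
have [|v vs uv] := net u.
  by rewrite norm2Z ger0_norm ?invr_ge0 ?norm2_ge0 // mulVf.
have := gt v vs; have := dotv_norm2_le (u - v) g.
rewrite dotvBl /u dotvZl -norm2_sqr expr2 mulKf //.
have : norm2 (u - v) * norm2 g <= 4^-1 * norm2 g by rewrite ler_wpM2r // ltW.
by rewrite -/u; lra.
Qed.

(* The weights 8 and 1 suit [norm2 x <= 1/4] and [norm2 y <= 2]. *)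
Lemma bform_polarization A (B : R) u v : A^T = A ->
  (forall w, `|bform A w w| <= B * dotv w w) ->
  `|bform A u v| <= B * (4 * dotv u u + dotv v v / 16).
Proof.
move=> sA hB.
have := hB (8 *: u - v); have := hB (8 *: u + v).
rewrite bformDl bformBl !bformBr !bformDr !bformZl !bformZr.
rewrite dotvDl dotvBl !dotvBr !dotvDr !dotvZl !dotvZr (bformC v u sA) (dotvC v u).
move: (bform A u u) (bform A u v) (bform A v v) (dotv u u) (dotv u v) (dotv v v).
move=> a b c a' b' c'; rewrite !ler_norml => /andP[h1 h2] /andP[h3 h4].
by apply/andP; split; lra.
Qed.

(** Let [B] be the supremum over the unit ball. By symmetry the values at [u] and at a nearby net
    point [v] differ by [bform A (u - v) (u + v)], at most [B / 2] after polarization. Hence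
    [B <= t + B / 2], which is conclusive because [B] is finite. *)
Lemma bform_le_net (s : seq 'rV[R]_p) (A : 'M[R]_p) (t : R) : A^T = A ->
  (forall v, v \in s -> norm2 v <= 1) ->
  (forall u, norm2 u <= 1 -> exists2 v, v \in s & norm2 (u - v) <= 4^-1) ->
  (forall v, v \in s -> `|bform A v v| <= t) ->
  forall u, `|bform A u u| <= 2 * t * dotv u u.
Proof.
move=> sA s1 net At.
pose E := [set `|bform A u u| | u in [set u | norm2 u <= 1]].
have E0 : E 0 by exists 0; rewrite /= ?norm20 // bform0l normr0.
have supE : has_sup E.
  split; first by exists 0.
  have [C C0 hC] := bform_bounded A.
  exists C => _ [u u1 <-]; apply: le_trans (hC u u) _.
  by rewrite -[leRHS]mulr1 ler_wpM2l ?(ltW C0) // mulr_ile1 ?norm2_ge0.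
pose B := sup E.
have B0 : 0 <= B by apply: ub_le_sup => //; case: supE.
have hB u : `|bform A u u| <= B * dotv u u.
  have [->|u0] := eqVneq u 0.
    by rewrite bform0l dotv0l normr0 mulr0.
  have : `|bform A ((norm2 u)^-1 *: u) ((norm2 u)^-1 *: u)| <= B.
    apply: ub_le_sup; first by case: supE.
    exists ((norm2 u)^-1 *: u) => //=.
    by apply: norm2_le => //; rewrite normalize // expr1n.
  have up : 0 < norm2 u.
    rewrite lt_neqAle norm2_ge0 andbT eq_sym.
    by apply: contraNneq u0 => /norm2_eq0 ->.
  rewrite bformZl bformZr mulrA -expr2 normrM ger0_norm ?sqr_ge0 //.
  by rewrite exprVn ler_pdivrMl ?exprn_gt0 // norm2_sqr mulrC.
have Bt : B <= 2 * t.
  suff : B <= t + B / 2 by lra.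
  apply: ge_sup; first by exists 0.
  move=> _ [u u1 <-]; have [v vs uv] := net u u1.
  set x := u - v; set y := u + v.
  have -> : bform A u u = bform A v v + bform A x y.
    rewrite /x /y bformBl !bformDr (bformC v u sA); ring.
  apply: le_trans (ler_normD _ _) _; apply: lerD; first exact: At.
  have xx : dotv x x <= 16^-1.
    rewrite -norm2_sqr; apply: le_trans (_ : 4^-1 ^+ 2 <= _).
      by rewrite ler_pXn2r ?nnegrE ?norm2_ge0 //.
    by rewrite expr2; lra.
  have yy : dotv y y <= 4.
    rewrite -norm2_sqr; apply: le_trans (_ : 2 ^+ 2 <= _); last by rewrite expr2; lra.
    rewrite ler_pXn2r ?nnegrE ?norm2_ge0 //; apply: le_trans (norm2D _ _) _.
    by have := s1 v vs; have : norm2 u <= 1 := u1; lra.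
  apply: le_trans (bform_polarization x y sA hB) _.
  have : B * (4 * dotv x x + dotv y y / 16) <= B * 2^-1 by rewrite ler_wpM2l //; lra.
  by [].
move=> u; apply: le_trans (hB u) _; by rewrite ler_wpM2r ?dotv_ge0.
Qed.

(** As [lambda_max] is a supremum over eigenvalues, the supremum [M] of the Rayleigh quotient must
    be shown to be an eigenvalue. Invertibility replaces the usual compactness argument. *)
Lemma bform_le_lambda_max A u : A^T = A ->
  bform A u u <= lambda_max A * dotv u u.
Proof.
move=> sA; have [->|u0] := eqVneq u 0.
  by rewrite bform0l dotv0l mulr0.
pose E := [set bform A v v | v in [set v | dotv v v = 1]].
have En : E !=set0.
  by eexists; exists ((norm2 u)^-1 *: u) => //=; exact: normalize.
have supE : has_sup E.
  split => //; have [C C0 hC] := bform_bounded A.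
  exists C => _ [v v1 <-]; apply: le_trans (ler_norm _) (le_trans (hC v v) _).
  by rewrite -expr2 norm2_sqr v1 mulr1.
pose M := sup E.
have hM v : bform A v v <= M * dotv v v.
  have [->|v0] := eqVneq v 0.
    by rewrite bform0l dotv0l mulr0.
  have vp : 0 < norm2 v.
    rewrite lt_neqAle norm2_ge0 andbT eq_sym.
    by apply: contraNneq v0 => /norm2_eq0 ->.
  have : bform A ((norm2 v)^-1 *: v) ((norm2 v)^-1 *: v) <= M.
    apply: ub_le_sup; first by case: supE.
    by exists ((norm2 v)^-1 *: v) => //=; exact: normalize.
  rewrite bformZl bformZr mulrA -expr2.
  by rewrite exprVn ler_pdivrMl ?exprn_gt0 // norm2_sqr mulrC.
suff ME : eigenvalue A M.
  apply: le_trans (hM u) _; rewrite ler_wpM2r ?dotv_ge0 //.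
  apply: ub_le_sup => //; exists M => a /= /eigenvalueP[v vA v0].
  have := hM v; rewrite /bform vA dotvZl ler_pM2r // lt_neqAle dotv_ge0 andbT eq_sym.
  by apply: contraNneq v0 => /dotv_eq0 ->.
(* otherwise [M - A] is invertible and positive semidefinite, hence coercive,
   which contradicts the definition of [M] *)
pose D := M%:M - A.
have D0 v : 0 <= bform D v v by rewrite bform_mxB bform_scalar subr_ge0.
have sD : D^T = D by rewrite /D linearB /= tr_scalar_mx sA.
apply: contrapT => nE.
have Du : D \in unitmx.
  rewrite -row_free_unit -kermx_eq0; apply: contrapT => /negP /rowV0Pn[v].
  rewrite sub_kermx mulmxBr mul_mx_scalar subr_eq0 => /eqP vA v0; apply: nE.
  by apply/eigenvalueP; exists v.
have [C C0 hC] := bform_bounded (invmx D).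
suff : M <= M - C^-1 by rewrite lerBrDr gerDl; have := C0; rewrite -invr_gt0; lra.
apply: ge_sup => // _ [v v1 <-].
rewrite lerBrDr -lerBrDl; have -> : M - bform A v v = bform D v v.
  by rewrite bform_mxB bform_scalar v1 mulr1.
(* With [w = v *m invmx D], [bform D v w = dotv v v = 1] and [bform D w w = dotv v w <= C], so
   [1 <= bform D v v * C]. *)
have := bform_CauchySchwarz v (v *m invmx D) sD D0.
rewrite (bformC v _ sD) {1 3}/bform mulmxKV // v1 expr1n => h.
rewrite -[C^-1]mul1r ler_pdivrMr //; apply: le_trans h _; rewrite ler_wpM2l //.
rewrite dotvC -/(bform _ _ _); apply: le_trans (ler_norm _) (le_trans (hC v v) _).
by rewrite -expr2 norm2_sqr v1 mulr1.
Qed.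

(** Apply the previous bound to [- A]; [inf] is defined as the opposite of the [sup] of the
    opposites. *)
Lemma lambda_min_le_bform A u : A^T = A ->
  lambda_min A * dotv u u <= bform A u u.
Proof.
move=> sA; have sA' : (- A)^T = - A by rewrite linearN /= sA.
have := bform_le_lambda_max u sA'.
have -> : lambda_max (- A) = - lambda_min A.
  rewrite /lambda_max /lambda_min /inf opprK; congr sup.
  apply/seteqP; split => [a /eigenvalueP[v vA v0]|_ [a /eigenvalueP[v vA v0] <-]] /=.
    exists (- a); rewrite ?opprK //=; apply/eigenvalueP; exists v => //.
    by rewrite scaleNr -vA mulmxN opprK.
  by apply/eigenvalueP; exists v => //; rewrite mulmxN vA scaleNr.
rewrite -(sub0r A) bform_mxB {1}/bform mulmx0 dotv0l; lra.
Qed.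

(* Only [f th <= f th0] is used to bound a minimizer, via
   [m |h|^2 <= bform H h h <= 2 dotv g h]. *)
Lemma argmin_quadratic (f : 'rV[R]_p -> R) (H : 'M[R]_p) (g th0 : 'rV[R]_p) (m : R) :
  H^T = H -> 0 < m -> (forall v, m * dotv v v <= bform H v v) ->
  (forall h, f (th0 + h) = f th0 + bform H h h - 2 * dotv g h) ->
  (exists th, is_argmin f th) /\
  forall th, is_argmin f th -> norm2 (th - th0) <= 2 * norm2 g / m.
Proof.
move=> sH m0 Hm fE; split.
  have Hu : H \in unitmx.
    rewrite -row_free_unit -kermx_eq0; apply: contrapT => /negP /rowV0Pn[v].
    rewrite sub_kermx => /eqP vH v0; have := Hm v.
    rewrite /bform vH dotv0l pmulr_rle0 // => v1.
    by case/negP: v0; apply/eqP/dotv_eq0/eqP; rewrite eq_le v1 dotv_ge0.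
  (* Completing the square: the excess over this point is [bform H (h - h0) (h - h0)]. *)
  pose h0 := g *m invmx H; exists (th0 + h0) => th.
  have -> : f th = f (th0 + (th - th0)) by rewrite addrC subrK.
  rewrite !fE; move: (th - th0) => h.
  have h0H v : bform H h0 v = dotv g v by rewrite /bform mulmxKV.
  move: h0 h0H => h0 h0H.
  have := Hm (h - h0); have := mulr_ge0 (ltW m0) (dotv_ge0 (h - h0)).
  rewrite !bformBl !bformBr (bformC h h0 sH) !h0H; lra.
move=> th /(_ th0); rewrite -[th](subrK th0) addrC fE (addrC th0) addrK.
move: (th - th0) => h le0; have := Hm h; have := dotv_norm2_le g h.
rewrite -norm2_sqr => a b; have [->|h0] := eqVneq (norm2 h) 0.
  by rewrite divr_ge0 ?mulr_ge0 ?norm2_ge0 // ltW.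
have hp : 0 < norm2 h by rewrite lt_neqAle eq_sym h0 norm2_ge0.
rewrite ler_pdivlMr // -(ler_pM2r hp); lra.
Qed.

End Nets.

(** * Independence and concentration *)

Section Independence.
Context {R : realType} {d : measure_display} {Omega : measurableType d}.
Variable P : probability Omega R.
Import HBNNSimple.

Lemma integral_simple_comp (G X : Omega -> R) (a : {nnsfun R >-> R}) :
  measurable_fun setT G -> measurable_fun setT X -> (forall w, 0 <= G w) ->
  (\int[P]_w (G w * a (X w))%:E = \sum_(i < #|` fset_set (range a)|)
    ((fset_set (range a))`_i)%:E * \int[P]_w
      (G w * \1_(X @^-1` (a @^-1` [set (fset_set (range a))`_i])) w)%:E)%E.
Proof.
move=> mG mX G0; set s := fset_set (range a).
have s0 (i : 'I_(#|` s|)) : 0 <= s`_i.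
  have : s`_i \in s by exact: mem_nth.
  by rewrite in_fset_set => [/set_mem[x _ <-]|] //.
have mind r : measurable_fun setT (fun w => \1_(X @^-1` (a @^-1` [set r])) w : R).
  apply: measurable_indic; rewrite -[X in measurable X]setTI; exact: mX.
transitivity (\int[P]_w (\sum_(i < #|` s|) (s`_i)%:E *
    (G w * \1_(X @^-1` (a @^-1` [set s`_i])) w)%:E))%E.
  apply: eq_integral => w _; rewrite fimfunEord -/s mulr_sumr -sumEFin.
  by apply: eq_bigr => i _; rewrite -EFinM mulrCA.
rewrite ge0_integral_sum //.
- apply: eq_bigr => i _; rewrite ge0_integralZl_EFin //.
  + by move=> w _; rewrite lee_fin mulr_ge0.
  + by apply/measurable_EFinP; exact: measurable_funM.
- move=> i; apply/measurable_EFinP; apply: measurable_funM; first exact: measurable_cst.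
  exact: measurable_funM.
- by move=> i w _; rewrite lee_fin !mulr_ge0.
Qed.

(** Simple functions are composed with [X] instead of approximating [X] on [Omega]: their level sets
    are then preimages under [X], the only events for which factorization is assumed. The
    approximated function is the absolute value, which must be nonnegative on all of [R]. *)
Lemma integral_factor (G X : Omega -> R) :
  measurable_fun setT G -> measurable_fun setT X ->
  (forall w, 0 <= G w) -> (forall w, 0 <= X w) ->
  (\int[P]_w (G w)%:E)%E \is a fin_num ->
  (forall B, measurable B ->
    \int[P]_w (G w * \1_(X @^-1` B) w)%:E = \int[P]_w (G w)%:E * P (X @^-1` B))%E ->
  (\int[P]_w (G w * X w)%:E = \int[P]_w (G w)%:E * \int[P]_w (X w)%:E)%E.
Proof.
move=> mG mX G0 X0 finG GX.
have mabs : measurable_fun setT (fun x : R => `|x|%:E).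
  by apply/measurable_EFinP; exact: normr_measurable.
pose a := nnsfun_approx measurableT mabs.
have cvg_a w : (a n (X w))%:E @[n --> \oo] --> (X w)%:E.
  rewrite -[X in _ --> X%:E](ger0_norm (X0 w)).
  by apply: (@cvg_nnsfun_approx _ _ _ _ measurableT _ mabs) => //.
have nd_a w : nondecreasing_seq (fun n => a n (X w)).
  by move=> m n mn; have /lefP := @nd_nnsfun_approx _ _ _ _ measurableT _ mabs m n mn; apply.
have ma n : measurable_fun setT (fun w => a n (X w)).
  by apply: measurableT_comp mX; exact: measurable_funPT.
have cvg_int (F : Omega -> R) : measurable_fun setT F -> (forall w, 0 <= F w) ->
    (\int[P]_w (F w * a n (X w))%:E @[n --> \oo] --> \int[P]_w (F w * X w)%:E)%E.
  move=> mF F0; have -> : (\int[P]_w (F w * X w)%:E =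
      \int[P]_w limn (fun n => (F w * a n (X w))%:E))%E.
    apply: eq_integral => w _; apply/esym/cvg_lim => //.
    under eq_fun do rewrite EFinM.
    by rewrite EFinM; apply: cvgeZl.
  apply: cvg_monotone_convergence => //.
  - by move=> n; apply/measurable_EFinP; exact: measurable_funM.
  - by move=> n w _; rewrite lee_fin mulr_ge0.
  - by move=> w _ m n mn; rewrite lee_fin ler_wpM2l // nd_a.
have /cvg_lim <- // := cvg_int G mG G0.
have := cvg_int (cst 1) (measurable_cst _) (fun=> ler01).
under [X in _ --> X]eq_integral do rewrite mul1r.
move=> /(cvgeZl finG) /cvg_lim <- //.
congr (limn _); apply/funext => n; rewrite !integral_simple_comp //.
rewrite ge0_sume_distrr; last first.
  move=> i; rewrite mule_ge0 //.
    have : (fset_set (range (a n)))`_i \in fset_set (range (a n)) by exact: mem_nth.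
    by rewrite in_fset_set => [/set_mem[x _ <-]|] //; rewrite lee_fin.
  by apply: integral_ge0 => w _; rewrite lee_fin mulr_ge0.
apply: eq_bigr => i _; rewrite muleCA; congr (_ * _)%E.
set B := (a n) @^-1` _; have mB : measurable B by exact: measurable_sfunP.
rewrite GX //; congr (_ * _)%E; under eq_integral do rewrite mul1r.
rewrite integral_indic // ?setIT // -[X in measurable X]setTI; exact: mX.
Qed.

Lemma integral_prod_indep (I : finType) (E : I -> set (set Omega))
    (X : I -> Omega -> R) (J : {set I}) :
  mutually_independent P E -> (forall i A, E i A -> measurable A) ->
  (forall i, measurable_fun setT (X i)) -> (forall i w, 0 <= X i w) ->
  (forall i B, measurable B -> E i (X i @^-1` B)) ->
  (forall i, (\int[P]_w (X i w)%:E)%E \is a fin_num) ->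
  (\int[P]_w (\prod_(i in J) X i w)%:E = \prod_(i in J) \int[P]_w (X i w)%:E)%E.
Proof.
move=> indE mE mX X0 EX finX.
have key (s : seq I) : uniq s -> forall (K : {set I}) (A : I -> set Omega),
    (forall i, i \in s -> i \notin K) -> (forall i, i \in K -> E i (A i)) ->
    (\int[P]_w (\prod_(i <- s) X i w * \prod_(i in K) \1_(A i) w)%:E =
     (\prod_(i <- s) \int[P]_w (X i w)%:E) * \prod_(i in K) P (A i))%E.
  elim: s => [_ K A _ EA|i s IH /= /andP[nis us] K A sK EA].
    rewrite big_nil mul1e -indE //.
    under eq_integral do rewrite big_nil mul1r.
    rewrite -[X in P X]setIT -integral_indic //; last first.
      apply: fin_bigcap_measurable; first exact: finite_finset.
      by move=> i /= iK; exact: mE (EA i iK).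
    apply: eq_integral => w _; congr EFin; rewrite indicE.
    have [wA|wA] := boolP (w \in _); last first.
      have [i iK iA] : exists2 i, i \in K & ~ A i w.
        apply: contrapT => h; case/negP: wA; apply/mem_set => i /= iK.
        by apply: contrapT => h'; apply: h; exists i.
      by rewrite (bigD1 i) //= indicE memNset // mul0r.
    rewrite big1 // => i iK; rewrite indicE mem_set //.
    exact: (set_mem wA).
  pose G w := \prod_(i <- s) X i w * \prod_(i in K) \1_(A i) w.
  have mG : measurable_fun setT G.
    apply: measurable_funM; first exact: measurable_prod.
    under eq_fun do rewrite -big_enum.
    apply: measurable_prod => i0; rewrite mem_enum => i0K.
    exact/measurable_indic/mE/(EA _ i0K).
  have G0 w : 0 <= G w by rewrite mulr_ge0 // prodr_ge0.
  have IG : (\int[P]_w (G w)%:E =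
     (\prod_(i <- s) \int[P]_w (X i w)%:E) * \prod_(i in K) P (A i))%E.
    by apply: IH => // j js; apply: sK; rewrite inE js orbT.
  transitivity (\int[P]_w (G w * X i w)%:E)%E.
    by apply: eq_integral => w _; rewrite big_cons /G; congr EFin; ring.
  rewrite integral_factor // ?IG ?big_cons.
  - by rewrite muleC muleA.
  - rewrite fin_numM //.
      by elim/big_ind : _ => // x y; exact: fin_numM.
    elim/big_ind : _ => // [x y|j jK]; first exact: fin_numM.
    by rewrite fin_num_measure //; exact: mE (EA _ jK).
  move=> B mB; pose A' j := if j == i then X i @^-1` B else A j.
  have iK : i \notin K by apply: sK; rewrite inE eqxx.
  have -> : (\int[P]_w (G w * \1_(X i @^-1` B) w)%:E =
      \int[P]_w (\prod_(i <- s) X i w * \prod_(j in (i |: K)%SET) \1_(A' j) w)%:E)%E.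
    apply: eq_integral => w _; rewrite big_setU1 //= /A' eqxx /G -mulrA; congr EFin.
    congr (_ * _); rewrite mulrC; congr (_ * _); apply: eq_bigr => j jK.
    by case: eqP => // ji; rewrite -ji jK in iK.
  rewrite IH //; first last.
  - move=> j; rewrite !inE /A'; case: eqP => [-> _|_ /= jK]; first exact: EX.
    exact: EA.
  - move=> j js; rewrite !inE negb_or sK ?inE ?js ?orbT // andbT.
    by apply: contraNneq nis => <-.
  rewrite big_setU1 //= /A' eqxx -muleA; congr (_ * _)%E; rewrite muleC; congr (_ * _)%E.
  apply: eq_bigr => j jK; by case: eqP => // ji; rewrite -ji jK in iK.
have := key (enum J) (enum_uniq _) finset.set0 (fun=> set0).
rewrite !big_enum !big_set0 mule1 => <-; [|by move=> i _; rewrite finset.in_set0|by move=> i; rewrite finset.in_set0].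
by apply: eq_integral => w _; rewrite big_set0 mulr1 big_enum.
Qed.

End Independence.

(** * Moment generating functions and Chernoff bounds *)

Section Concentration.
Context {R : realType} {d : measure_display} {Omega : measurableType d}.
Variable P : probability Omega R.

(** The Orlicz [psi_1] norm of [W] is at most [kappa]. *)
Definition subexponential (kappa : R) (W : Omega -> R) : Prop :=
  measurable_fun setT W /\ (\int[P]_w (expR (`|W w| / kappa))%:E <= 2%:E)%E.

Lemma measurable_expR_comp (W : Omega -> R) :
  measurable_fun setT W -> measurable_fun setT (fun w => expR (W w)).
Proof. exact: measurableT_comp. Qed.

Lemma subexponential_exp_integrable kappa W : subexponential kappa W ->
  P.-integrable setT (fun w => (expR (`|W w| / kappa))%:E).
Proof.
move=> [mW h]; apply/integrableP; split.
  apply/measurable_EFinP/measurable_expR_comp; apply: measurable_funM => //.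
  exact: measurableT_comp.
under eq_integral do rewrite gee0_abs ?lee_fin ?expR_ge0 //.
by apply: le_lt_trans h _; rewrite ltry.
Qed.

Lemma subexponential_integrable kappa W : 0 < kappa -> subexponential kappa W ->
  P.-integrable setT (EFin \o W).
Proof.
move=> k0 sW; have [mW _] := sW.
have := subexponential_exp_integrable sW => /(integrableZl measurableT kappa).
apply: le_integrable => //; first exact/measurable_EFinP.
move=> w _ /=; rewrite lee_fin [leRHS]ger0_norm ?mulr_ge0 ?expR_ge0 ?(ltW k0) //.
rewrite -ler_pdivrMl // mulrC; apply: le_trans (expR_ge1Dx _); lra.
Qed.

Lemma expectation_fine (W : Omega -> R) : P.-integrable setT (EFin \o W) ->
  (\int[P]_w (W w)%:E = (fine 'E_P[W])%:E)%E.
Proof. by move=> iW; rewrite unlock fineK //; exact: integrable_fin_num. Qed.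

(** With [v = |W| / kappa], the remainder is at most [(s * kappa) ^+ 2 * v ^+ 2 * expR (v / 2)], and
    [v ^+ 2 <= 16 * expR (v / 2)]; the expectation of [expR v] contributes the last factor [2] of
    [32]. The bound stays affine in the mean so that it can be averaged over indices before
    exponentiation. *)
Lemma mgf_le kappa W (s : R) : 0 < kappa -> subexponential kappa W ->
  `|s| * kappa <= 2^-1 ->
  (\int[P]_w (expR (s * W w))%:E <=
    (1 + s * fine 'E_P[W] + 32 * s ^+ 2 * kappa ^+ 2)%:E)%E.
Proof.
move=> k0 sW sk; have [mW hW] := sW.
have iW := subexponential_integrable k0 sW.
have iE := subexponential_exp_integrable sW.
pose c := 16 * s ^+ 2 * kappa ^+ 2.
have c0 : 0 <= c by rewrite /c -mulrA -exprMn mulr_ge0 // sqr_ge0.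
have pw w : expR (s * W w) <= 1 + s * W w + c * expR (`|W w| / kappa).
  apply: le_trans (expR_le_quadratic _) _; rewrite lerD2l.
  set v := `|W w| / kappa.
  have v0 : 0 <= v by rewrite divr_ge0 // ltW.
  have Wv : `|W w| = kappa * v by rewrite /v mulrC divfK // gt_eqF.
  have -> : (s * W w) ^+ 2 = s ^+ 2 * kappa ^+ 2 * v ^+ 2.
    by rewrite exprMn -(real_normK (num_real (W w))) Wv exprMn mulrA.
  have e1 : expR `|s * W w| <= expR (v / 2).
    by rewrite ler_expR normrM Wv mulrA [leRHS]mulrC ler_wpM2r.
  have e2 : v ^+ 2 <= 16 * expR (v / 2).
    have h : v / 4 <= expR (v / 4) by apply: le_trans (expR_ge1Dx _); lra.
    have -> : v / 2 = v / 4 + v / 4 by field.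
    rewrite expRD -expr2 (_ : v ^+ 2 = 16 * (v / 4) ^+ 2); last by field.
    by rewrite ler_pM2l // ler_pXn2r // nnegrE ?expR_ge0 // divr_ge0.
  have e3 : v ^+ 2 * expR `|s * W w| <= 16 * expR v.
    have -> : 16 * expR v = (16 * expR (v / 2)) * expR (v / 2).
      by rewrite -mulrA -expRD; congr (_ * expR _); field.
    by apply: ler_pM => //; rewrite ?sqr_ge0 ?expR_ge0.
  rewrite -mulrA (_ : c * _ = s ^+ 2 * kappa ^+ 2 * (16 * expR v)); last by rewrite /c; ring.
  by rewrite ler_wpM2l // mulr_ge0 ?sqr_ge0.
have i1 : P.-integrable setT (fun w : Omega => (1 : R)%:E).
  exact: finite_measure_integrable_cst.
have i2 : P.-integrable setT (fun w : Omega => (s * W w)%:E).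
  by have := integrableZl measurableT s iW.
have i3 : P.-integrable setT (fun w : Omega => (c * expR (`|W w| / kappa))%:E).
  by have := integrableZl measurableT c iE.
apply: le_trans (_ : \int[P]_w (1 + s * W w + c * expR (`|W w| / kappa))%:E <= _)%E.
  apply: ge0_le_integral => //.
  - apply/measurable_EFinP; apply: (measurable_expR_comp (W := fun w => s * W w)).
    exact: measurable_funM.
  - apply/measurable_EFinP; apply: measurable_funD.
      by apply: measurable_funD => //; exact: measurable_funM.
    by apply: measurable_funM => //; apply/measurable_EFinP; case/integrableP: iE.
  - by move=> w _; rewrite lee_fin.
under eq_integral do rewrite EFinD EFinD.
rewrite integralD //=; last exact: integrableD.
rewrite integralD //= integral_cst // [X in (1 * X)%E](probability_setT P) mule1.
have -> : (\int[P]_w (s * W w)%:E = (s * fine 'E_P[W])%:E)%E.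
  by under eq_integral do rewrite EFinM; rewrite integralZl // expectation_fine.
rewrite EFinD leeD2l //.
under eq_integral do rewrite EFinM; rewrite integralZl //.
have -> : 32 * s ^+ 2 * kappa ^+ 2 = c * 2 by rewrite /c; ring.
by rewrite [X in (_ <= X)%E]EFinM; apply: lee_wpmul2l; rewrite ?lee_fin.
Qed.

(** The restriction to [D] is for the random subset, whose sums are controlled only where it has the
    prescribed size. *)
Lemma markov_expR (D : set Omega) (Y : Omega -> R) (b m : R) :
  measurable D -> measurable_fun setT Y ->
  (\int[P]_w (expR (Y w) * \1_D w)%:E <= (expR m)%:E)%E ->
  (P (D `&` [set w | (b <= Y w)%R]) <= (expR (m - b))%:E)%E.
Proof.
move=> mD mY h.
have mE : measurable (D `&` [set w | (b <= Y w)%R]).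
  apply: measurableI => //; rewrite (_ : [set _ | _] = Y @^-1` `[b, +oo[%classic).
    by rewrite -[X in measurable X]setTI; apply: mY => //; exact: measurable_itv.
  by apply/seteqP; split => w /=; rewrite in_itv /= andbT.
have mF : measurable_fun setT (fun w => (expR (Y w) * \1_D w)%:E).
  apply/measurable_EFinP; apply: measurable_funM; first exact: measurable_expR_comp.
  exact: measurable_indic.
rewrite -[X in P X]setIT -integral_indic //.
apply: le_trans (_ : \int[P]_w ((expR (- b))%:E * (expR (Y w) * \1_D w)%:E) <= _)%E.
  apply: ge0_le_integral => //.
  - exact/measurable_EFinP/measurable_indic.
  - exact: measurable_funeM.
  - move=> w _; rewrite -EFinM lee_fin !indicE in_setI mulrA -expRD.
    case: (w \in D); rewrite ?mulr0 //= mulr1.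
    case: (boolP (w \in _)) => [/set_mem /= bY|_]; rewrite ?expR_ge0 //=.
    by rewrite -[leLHS]expR0 ler_expR; lra.
rewrite ge0_integralZl_EFin ?expR_ge0 //.
by rewrite addrC expRD EFinM; apply: lee_wpmul2l; rewrite ?lee_fin ?expR_ge0.
Qed.

Lemma chernoff_average (D : set Omega) (Y : Omega -> R) (n : nat) (mu kappa t : R) :
  measurable D -> measurable_fun setT Y -> (0 < n)%N -> 0 < kappa ->
  0 <= t <= 32 * kappa ->
  (forall s, `|s| * kappa <= 2^-1 -> (\int[P]_w (expR (s * Y w) * \1_D w)%:E <=
     (expR (n%:R * (s * mu + 32 * s ^+ 2 * kappa ^+ 2)))%:E)%E) ->
  (P (D `&` [set w | (t < `|n%:R^-1 * Y w - mu|)%R]) <=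
    (2 * expR (- (n%:R * t ^+ 2 / (128 * kappa ^+ 2))))%:E)%E.
Proof.
move=> mD mY n0 k0 /andP[t0 tk] H.
have n0' : 0 < n%:R :> R by rewrite ltr0n.
have k0' : kappa != 0 by rewrite gt_eqF.
(* Minimizes [32 * s ^+ 2 * kappa ^+ 2 - s * t], with value [- t ^+ 2 / (128 * kappa ^+ 2)]. The
   condition [t <= 32 * kappa] is exactly [s * kappa <= 1/2]. *)
pose s := t / (64 * kappa ^+ 2).
have s0 : 0 <= s by rewrite divr_ge0 // mulr_ge0 // sqr_ge0.
have sk : s * kappa <= 2^-1.
  rewrite (_ : s * kappa = t / (64 * kappa)); last by rewrite /s; field.
  by rewrite ler_pdivrMr ?mulr_gt0 //; lra.
pose b sg := n%:R * (sg * s * mu + s * t).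
have side sg : sg ^+ 2 = 1 -> (P (D `&` [set w | (b sg <= sg * s * Y w)%R]) <=
    (expR (- (n%:R * t ^+ 2 / (128 * kappa ^+ 2))))%:E)%E.
  move=> sg2.
  have -> : - (n%:R * t ^+ 2 / (128 * kappa ^+ 2)) =
      n%:R * (sg * s * mu + 32 * (sg * s) ^+ 2 * kappa ^+ 2) - b sg.
    by rewrite /b exprMn sg2 /s; field.
  have mY2 : measurable_fun setT (fun w => sg * s * Y w) by exact: measurable_funM.
  apply: (markov_expR (b sg) mD mY2).
  apply: H; have : `|sg| = 1.
    by apply/eqP; rewrite -(eqrXn2 (ltn0Sn 1)) // real_normK ?num_real // sg2 expr1n.
  by rewrite normrM => ->; rewrite mul1r ger0_norm.
have mS sg : measurable (D `&` [set w | (b sg <= sg * s * Y w)%R]).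
  apply: measurableI => //.
  rewrite (_ : [set _ | _] = (fun w => sg * s * Y w) @^-1` `[b sg, +oo[%classic).
    rewrite -[X in measurable X]setTI; apply: measurable_funM => //; exact: measurable_itv.
  by apply/seteqP; split => w /=; rewrite in_itv /= andbT.
set e := expR (- _); have -> : 2 * e = e + e by ring.
rewrite EFinD.
apply: le_trans (_ : P ((D `&` [set w | (b 1 <= 1 * s * Y w)%R]) `|`
   (D `&` [set w | (b (-1) <= -1 * s * Y w)%R])) <= _)%E; last first.
  have PU := measureU2 P (mS 1) (mS (-1)); apply: le_trans PU _.
  by apply: leeD; apply: side; rewrite ?expr1n // sqrrN expr1n.
apply: le_measure.
- apply/mem_set/measurableI => //.
  rewrite (_ : [set _ | _] = (fun w => `|n%:R^-1 * Y w - mu|) @^-1` `]t, +oo[%classic).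
    have mf : measurable_fun setT (fun w => `|n%:R^-1 * Y w - mu|).
      apply: measurableT_comp => //; apply: measurable_funB => //.
      exact: measurable_funM.
    by rewrite -[X in measurable X]setTI; apply: mf => //; exact: measurable_itv.
  by apply/seteqP; split => w /=; rewrite in_itv /= andbT.
- exact/mem_set/measurableU.
move=> w [Dw /= tw]; set y := n%:R^-1 * Y w in tw.
have Yy : Y w = n%:R * y by rewrite /y mulVKf // gt_eqF.
have nn : 0 <= n%:R * s by rewrite mulr_ge0.
have [yl|yl] := leP 0 (y - mu).
  left; split => //=; rewrite /b Yy; rewrite ger0_norm // in tw.
  have : n%:R * s * t <= n%:R * s * (y - mu) by rewrite ler_wpM2l // ltW.
  by lra.
right; split => //=; rewrite /b Yy; rewrite ltr0_norm // in tw.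
have : n%:R * s * t <= n%:R * s * - (y - mu) by rewrite ler_wpM2l // ltW.
by lra.
Qed.

End Concentration.

(** * Sums over the full sample and over a uniformly random subset *)

Section RandomSubsets.
Context {R : realType} {d : measure_display} {Omega : measurableType d}.
Variable P : probability Omega R.

(** Extracts from the joint family the retained samples with the subset, and the forget samples. *)
Lemma mutually_independent_inj (I I' : finType) (h : I' -> I)
    (E : I -> set (set Omega)) : injective h ->
  mutually_independent P E -> mutually_independent P (fun j => E (h j)).
Proof.
move=> hI indE J A EA.
pose A' i := if [pick j | h j == i] is Some j then A j else setT.
have A'h j : A' (h j) = A j.
  rewrite /A'; case: pickP => [k /eqP /hI -> //|/(_ j)]; by rewrite eqxx.
have := indE (h @: J)%SET A'.
rewrite big_imset /=; last by move=> x y _ _; exact: hI.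
under eq_bigr do rewrite A'h.
move=> <-; last by move=> _ /imsetP[j jJ ->]; rewrite A'h; exact: EA.
congr (P _); apply/seteqP; split => w h1 i /=.
  by move=> /imsetP[j jJ ->]; rewrite A'h; exact: h1.
by move=> iJ; rewrite -A'h; apply: h1 => /=; exact: imset_f.
Qed.

(** Averaging before [1 + x <= expR x] makes only the average of the means appear in the
    exponent. *)
Lemma mgf_average_le (N n : nat) (W : 'I_N -> Omega -> R) (kappa s : R) :
  (0 < N)%N -> 0 < kappa -> (forall i, subexponential P kappa (W i)) ->
  `|s| * kappa <= 2^-1 ->
  (N%:R^-1 * \sum_i fine (\int[P]_w (expR (s * W i w))%:E)%E) ^+ n <=
  expR (n%:R * (s * (N%:R^-1 * \sum_i fine 'E_P[W i]) + 32 * s ^+ 2 * kappa ^+ 2)).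
Proof.
move=> N0 k0 sW sk; have Np : 0 < N%:R :> R by rewrite ltr0n.
rewrite expRM_natl lerXn2r ?nnegrE ?expR_ge0 //.
  rewrite mulr_ge0 ?invr_ge0 ?ler0n // sumr_ge0 // => i _; rewrite fine_ge0 //.
  by apply: integral_ge0 => w _; rewrite lee_fin expR_ge0.
apply: le_trans (expR_ge1Dx _).
apply: le_trans (_ : N%:R^-1 * \sum_(i < N) (1 + s * fine 'E_P[W i] + 32 * s ^+ 2 * kappa ^+ 2) <= _).
  rewrite ler_wpM2l ?invr_ge0 ?ler0n //; apply: ler_sum => i _.
  have h := mgf_le k0 (sW i) sk.
  rewrite -lee_fin fineK // fin_real // (lt_le_trans (ltNyr 0%R)) /=.
    by apply: le_lt_trans h _; rewrite ltry.
  by apply: integral_ge0 => w _; rewrite lee_fin expR_ge0.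
rewrite !big_split /= !sumr_const card_ord -mulr_sumr.
rewrite -[_ *+ N]mulr_natl -[X in _ + X]mulr_natl le_eqVlt; apply/orP; left; apply/eqP.
by field; rewrite gt_eqF.
Qed.

Lemma integral_expR_fin_num kappa (W : Omega -> R) (s : R) : 0 < kappa ->
  subexponential P kappa W -> `|s| * kappa <= 2^-1 ->
  (\int[P]_w (expR (s * W w))%:E)%E \is a fin_num.
Proof.
move=> k0 sW sk; have h := mgf_le k0 sW sk.
rewrite ge0_fin_numE; first by apply: le_lt_trans h _; rewrite ltry.
by apply: integral_ge0 => w _; rewrite lee_fin expR_ge0.
Qed.

Lemma preimage_expRM (W : Omega -> R) (s : R) (B : set R) : measurable B ->
  exists2 B' : set R, measurable B' & (fun w => expR (s * W w)) @^-1` B = W @^-1` B'.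
Proof.
move=> mB; exists ((fun x => expR (s * x)) @^-1` B) => //.
have mf : measurable_fun setT (fun x : R => expR (s * x)).
  by apply: measurable_expR_comp; exact: measurable_funM.
by rewrite -[X in measurable X]setTI; exact: mf.
Qed.

(** Maclaurin with [n = N], where the only subset is the full one. The factor [\1_setT] gives the
    shape expected by [chernoff_average]. *)
Lemma mgf_full_sum (N : nat) (W : 'I_N -> Omega -> R) (E : 'I_N -> set (set Omega))
    (kappa s : R) :
  (0 < N)%N -> 0 < kappa -> `|s| * kappa <= 2^-1 ->
  mutually_independent P E -> (forall i A, E i A -> measurable A) ->
  (forall i B, measurable B -> E i (W i @^-1` B)) ->
  (forall i, subexponential P kappa (W i)) ->
  (\int[P]_w (expR (s * \sum_i W i w) * \1_setT w)%:E <=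
    (expR (N%:R * (s * (N%:R^-1 * \sum_i fine 'E_P[W i]) + 32 * s ^+ 2 * kappa ^+ 2)))%:E)%E.
Proof.
move=> N0 k0 sk indE mE EW sW.
have -> : (\int[P]_w (expR (s * \sum_i W i w) * \1_setT w)%:E =
    \prod_(i in [set: 'I_N]%SET) \int[P]_w (expR (s * W i w))%:E)%E.
  rewrite -(@integral_prod_indep _ _ _ P _ E (fun i w => expR (s * W i w))) //.
  - apply: eq_integral => w _; rewrite indicT mulr1 mulr_sumr expR_sum; congr EFin.
    by apply: eq_bigl => i; rewrite finset.in_setT.
  - by move=> i; apply: measurable_expR_comp; apply: measurable_funM => //; case: (sW i).
  - by move=> i B mB; have [B' mB' ->] := preimage_expRM (W i) s mB; exact: EW.
  - by move=> i; exact: integral_expR_fin_num (sW i) sk.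
pose m i := fine (\int[P]_w (expR (s * W i w))%:E)%E.
have -> : (\prod_(i in [set: 'I_N]%SET) \int[P]_w (expR (s * W i w))%:E =
    (\prod_(i in [set: 'I_N]%SET) m i)%:E)%E.
  rewrite -prodEFin; apply: eq_bigr => i _.
  by rewrite fineK //; exact: integral_expR_fin_num (sW i) sk.
rewrite lee_fin; apply: le_trans (mgf_average_le N N0 k0 sW sk).
have := @maclaurin _ N N m _ (leqnn N).
rewrite binn mul1r => h; apply: le_trans (h _).
  rewrite (big_pred1 [set: 'I_N]%SET) // => A /=.
  apply/eqP/eqP => [h2|->]; last by rewrite cardsT card_ord.
  by apply/eqP; rewrite eqEcard finset.subsetT cardsT card_ord h2 leqnn.
by move=> i; rewrite fine_ge0 // integral_ge0 // => w _; rewrite lee_fin expR_ge0.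
Qed.

(* Averaging the product of the moment generating functions over the random subset
   produces an elementary symmetric mean, so Maclaurin's inequality makes the heterogeneous
   summands behave like independent copies of a single averaged one. *)
Lemma mgf_random_subset (N n : nat) (S : Omega -> {set 'I_N}) (W : 'I_N -> Omega -> R)
    (E : option 'I_N -> set (set Omega)) (kappa s : R) :
  (0 < n)%N -> (n <= N)%N -> 0 < kappa -> `|s| * kappa <= 2^-1 ->
  mutually_independent P E -> (forall o A, E o A -> measurable A) ->
  (forall B : set {set 'I_N}, E None (S @^-1` B)) ->
  (forall i B, measurable B -> E (Some i) (W i @^-1` B)) ->
  (forall A : {set 'I_N}, #|A| = n -> P [set w | S w = A] = (('C(N, n))%:R^-1)%:E) ->
  (forall i, subexponential P kappa (W i)) ->
  (\int[P]_w (expR (s * \sum_(i in S w) W i w) * \1_[set w | #|S w| = n] w)%:E <=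
    (expR (n%:R * (s * (N%:R^-1 * \sum_i fine 'E_P[W i]) + 32 * s ^+ 2 * kappa ^+ 2)))%:E)%E.
Proof.
move=> n0 nN k0 sk indE mE ES EW PS sW.
have N0 : (0 < N)%N by exact: leq_trans nN.
pose m i := fine (\int[P]_w (expR (s * W i w))%:E)%E.
have m0 i : 0 <= m i.
  by rewrite fine_ge0 // integral_ge0 // => w _; rewrite lee_fin expR_ge0.
have mEx i : measurable_fun setT (fun w => expR (s * W i w)).
  by apply: measurable_expR_comp; apply: measurable_funM => //; case: (sW i).
(* The index [None] carries the indicator of [S = A], so independence of the subset and the samples
   is one more factor in [integral_prod_indep]. *)
pose X A (o : option 'I_N) w : R := if o is Some i then expR (s * W i w) else (S w == A)%:R.
have XNone A w : X A None w = \1_(S @^-1` [set A]) w.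
  by rewrite /X indicE; case: eqP => h; [rewrite mem_set | rewrite memNset].
have mX A o : measurable_fun setT (X A o).
  case: o => [i|]; first exact: mEx.
  rewrite (_ : X A None = \1_(S @^-1` [set A])); last by apply/funext => w; exact: XNone.
  exact/measurable_indic/(mE None).
have X0 A o w : 0 <= X A o w by case: o => [i|]; rewrite /X ?expR_ge0.
have intXN A : (\int[P]_w (X A None w)%:E = P [set w | S w = A])%E.
  under eq_integral do rewrite XNone.
  by rewrite integral_indic ?setIT //; exact: (mE None).
pose J (A : {set 'I_N}) := (None |: Some @: A)%SET.
have NJ (A : {set 'I_N}) : None \notin (Some @: A)%SET by apply/imsetP => -[].
have XJ (A : {set 'I_N}) w : \prod_(o in J A) X A o w = (S w == A)%:R * \prod_(i in A) expR (s * W i w).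
  rewrite big_setU1 ?NJ //; congr (_ * _).
  by rewrite big_imset //= => x y _ _ [].
have intX (A : {set 'I_N}) : #|A| = n -> (\int[P]_w (\prod_(o in J A) X A o w)%:E =
    (('C(N, n))%:R^-1 * \prod_(i in A) m i)%:E)%E.
  move=> An; rewrite (integral_prod_indep (E := E)) //; first last.
  - case=> [i|]; first exact: integral_expR_fin_num (sW i) sk.
    by rewrite intXN PS.
  - case=> [i|] B mB; last exact: (ES [set T | B ((T == A)%:R)]).
    by have [B' mB' ->] := preimage_expRM (W i) s mB; exact: EW.
  rewrite big_setU1 ?NJ // intXN PS // EFinM; congr (_ * _)%E.
  rewrite big_imset /=; last by move=> x y _ _ [].
  rewrite -prodEFin; apply: eq_bigr => i _.
  by rewrite fineK //; exact: integral_expR_fin_num (sW i) sk.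
pose T := [set A : {set 'I_N} | #|A| == n]%SET.
(* Decomposition according to the value of [S]; the indicator removes values of the wrong size. *)
have -> : (\int[P]_w (expR (s * \sum_(i in S w) W i w) * \1_[set w | #|S w| = n] w)%:E =
    \int[P]_w (\sum_(A <- enum T) (\prod_(o in J A) X A o w)%:E))%E.
  apply: eq_integral => w _; rewrite big_enum /= sumEFin; congr EFin.
  under [in RHS]eq_bigr do rewrite XJ.
  rewrite indicE; have [/eqP Sn|Sn] := boolP (#|S w| == n).
    rewrite mem_set // mulr1 (bigD1 (S w)) ?inE ?Sn //= eqxx mul1r [X in _ + X]big1 ?addr0.
      by rewrite mulr_sumr expR_sum.
    by move=> A /andP[_ /negbTE]; rewrite eq_sym => ->; rewrite mul0r.
  rewrite memNset ?mulr0; last by move=> /= h; rewrite h eqxx in Sn.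
  rewrite big1 // => A; rewrite inE => /eqP An; case: eqP => [h|_]; last by rewrite mul0r.
  by rewrite h An eqxx in Sn.
rewrite ge0_integral_sum //; last 2 first.
- move=> A; apply/measurable_EFinP.
  by under eq_fun do rewrite -big_enum; apply: measurable_prod => o _; exact: mX.
- by move=> A w _; rewrite lee_fin prodr_ge0.
rewrite big_enum /=.
under eq_bigr => A; first by rewrite inE => /eqP An; rewrite intX //; over.
rewrite sumEFin lee_fin -mulr_sumr; apply: le_trans (mgf_average_le n N0 k0 sW sk).
rewrite mulrC ler_pdivrMr ?ltr0n ?bin_gt0 // mulrC.
apply: le_trans (maclaurin m0 nN); rewrite le_eqVlt; apply/orP; left; apply/eqP.
by apply: eq_bigl => A; rewrite inE.
Qed.

End RandomSubsets.

(** * Sub-Gaussian linear forms and population minimizers *)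

Section Moments.
Context {R : realType} {d : measure_display} {Omega : measurableType d}.
Variable P : probability Omega R.

Lemma fine_expectation_sum (I : finType) (F : I -> Omega -> R) :
  (forall i, P.-integrable setT (EFin \o F i)) ->
  fine 'E_P[fun w => \sum_i F i w] = \sum_i fine 'E_P[F i].
Proof.
move=> iF; apply: EFin_inj; rewrite -expectation_fine; last first.
  rewrite (_ : _ \o _ = fun w => (\sum_i (F i w)%:E)%E); last first.
    by apply/funext => w /=; rewrite sumEFin.
  apply: (@integrable_sum _ _ _ P _ measurableT _ _ _ (fun i w => (F i w)%:E)) => i _.
  exact: iF.
under eq_integral do rewrite -sumEFin.
rewrite integral_sum // -sumEFin; apply: eq_bigr => i _.
exact: expectation_fine.
Qed.

Lemma fine_expectationZ (a : R) (F : Omega -> R) :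
  P.-integrable setT (EFin \o F) ->
  fine 'E_P[fun w => a * F w] = a * fine 'E_P[F].
Proof.
move=> iF; apply: EFin_inj; rewrite -expectation_fine; last first.
  by have := integrableZl measurableT a iF.
under eq_integral do rewrite EFinM.
by rewrite integralZl // expectation_fine.
Qed.

Lemma fine_expectationD (F G : Omega -> R) :
  P.-integrable setT (EFin \o F) -> P.-integrable setT (EFin \o G) ->
  fine 'E_P[fun w => F w + G w] = fine 'E_P[F] + fine 'E_P[G].
Proof.
move=> iF iG; apply: EFin_inj; rewrite -expectation_fine; last first.
  by have := integrableD measurableT iF iG.
under eq_integral do rewrite EFinD.
by rewrite integralD // EFinD !expectation_fine.
Qed.

Lemma fine_expectation_le (F G : Omega -> R) :
  P.-integrable setT (EFin \o F) -> P.-integrable setT (EFin \o G) ->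
  (forall w, F w <= G w) -> fine 'E_P[F] <= fine 'E_P[G].
Proof.
move=> iF iG FG; rewrite -lee_fin -!expectation_fine //.
by apply: le_integral => // w _; rewrite lee_fin.
Qed.

Lemma subexponential_expectation_le kappa (W : Omega -> R) : 0 < kappa ->
  subexponential P kappa W -> fine 'E_P[W] <= 2 * kappa.
Proof.
move=> k0 sW; have iW := subexponential_integrable k0 sW.
have iE := subexponential_exp_integrable sW.
rewrite -lee_fin -expectation_fine //.
apply: le_trans (_ : \int[P]_w (kappa%:E * (expR (`|W w| / kappa))%:E) <= _)%E.
  apply: le_integral => //; first exact: integrableZl.
  move=> w _; rewrite lee_fin -ler_pdivrMl // mulrC.
  apply: le_trans (_ : `|W w| / kappa <= _).
    by rewrite ler_pM2r ?invr_gt0 // ler_norm.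
  by apply: le_trans (expR_ge1Dx _); rewrite lerDr.
rewrite integralZl // mulrC EFinM; apply: lee_wpmul2l; first by rewrite lee_fin ltW.
by case: sW.
Qed.

Variables (p : nat) (K : R).
Hypothesis K0 : 0 < K.
Implicit Types (Z : Omega -> p.+1.-tuple R) (v : 'rV[R]_p) (c : R).

(* [lin_form (- th) 1 z] is the residual of [th] at the data point [z]. *)
Definition lin_form (v : 'rV[R]_p) (c : R) (z : p.+1.-tuple R) : R :=
  dotv v (xpart z) + c * ypart z.

Lemma lin_form0 v (z : p.+1.-tuple R) : lin_form v 0 z = dotv v (xpart z).
Proof. by rewrite /lin_form mul0r addr0. Qed.

Lemma lin_form_residual (th : 'rV[R]_p) (z : p.+1.-tuple R) :
  lin_form (- th) 1 z = ypart z - dotv (xpart z) th.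
Proof. by rewrite /lin_form dotvNl mul1r addrC dotvC. Qed.

Lemma measurable_lin_form v c : measurable_fun setT (lin_form v c).
Proof.
apply: measurable_funD; last first.
  by apply: measurable_funM => //; exact: measurable_tnth.
apply: measurable_sum => j; apply: measurable_funM => //.
under eq_fun do rewrite mxE; exact: measurable_tnth.
Qed.

(** Since [subgaussian_vec] tests unit vectors only, the coefficients [(v, c)] are divided by their
    norm [b <= a]. *)
Lemma subgaussian_lin_form Z v c (a : R) : measurable_fun setT Z ->
  subgaussian_vec P Z K -> 0 < a -> dotv v v + c ^+ 2 <= a ^+ 2 ->
  (\int[P]_w (expR ((lin_form v c (Z w) / a) ^+ 2 / K ^+ 2))%:E <= 2%:E)%E.
Proof.
move=> mZ sZ a0 va.
have mL (b : R) : measurable_fun setT (fun w => (expR ((lin_form v c (Z w) / b) ^+ 2 / K ^+ 2))%:E).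
  apply/measurable_EFinP.
  apply: (measurable_expR_comp (W := fun w => (lin_form v c (Z w) / b) ^+ 2 / K ^+ 2)).
  apply: measurable_funM => //; apply: measurable_funX.
  apply: measurable_funM => //.
  exact: measurableT_comp (measurable_lin_form v c) mZ.
pose b := Num.sqrt (dotv v v + c ^+ 2).
have s0 : 0 <= dotv v v + c ^+ 2 by rewrite addr_ge0 ?dotv_ge0 ?sqr_ge0.
have b2 : b ^+ 2 = dotv v v + c ^+ 2 by rewrite sqr_sqrtr.
have b0 : 0 <= b by exact: sqrtr_ge0.
(* Zero coefficients cannot be normalized, but then the form vanishes. *)
have [bz|bnz] := eqVneq b 0.
  have /eqP : dotv v v + c ^+ 2 = 0 by rewrite -b2 bz expr0n.
  rewrite paddr_eq0 ?dotv_ge0 ?sqr_ge0 // => /andP[/eqP/dotv_eq0 v0].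
  rewrite sqrf_eq0 => /eqP c0.
  have L0 w : lin_form v c (Z w) = 0 by rewrite /lin_form v0 c0 dotv0l mul0r addr0.
  under eq_integral do rewrite L0 mul0r expr0n mul0r expR0.
  by rewrite integral_cst // [X in (_ * X)%E](probability_setT P) mule1 lee_fin; lra.
have bp : 0 < b by rewrite lt_neqAle eq_sym bnz.
pose u : p.+1.-tuple R :=
  [tuple (if unlift ord_max k is Some j then v 0 j else c) / b | k < p.+1].
have uL (z : p.+1.-tuple R) : \sum_(k < p.+1) tnth u k * tnth z k = lin_form v c z / b.
  rewrite big_ord_recr /= tnth_mktuple unlift_none /lin_form mulrDl mulr_suml.
  congr (_ + _); last by rewrite /ypart mulrAC.
  apply: eq_bigr => j _; rewrite tnth_mktuple mxE.
  rewrite (_ : widen_ord _ j = lift ord_max j) ?liftK; first by rewrite mulrAC.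
  by apply: val_inj; exact/esym/lift_max.
have u1 : \sum_(k < p.+1) tnth u k ^+ 2 = 1.
  rewrite big_ord_recr /= tnth_mktuple unlift_none.
  rewrite (_ : \sum_(i < p) _ = dotv v v / b ^+ 2).
    by rewrite exprMn exprVn -mulrDl -b2 divff // expf_eq0.
  rewrite mulr_suml; apply: eq_bigr => j _; rewrite tnth_mktuple.
  rewrite (_ : widen_ord _ j = lift ord_max j) ?liftK; first by rewrite exprMn exprVn expr2.
  by apply: val_inj; exact/esym/lift_max.
have := sZ u u1; rewrite unlock.
under eq_integral do rewrite uL.
apply: le_trans; apply: ge0_le_integral => // w _; rewrite lee_fin ler_expR.
rewrite ler_wpM2r ?invr_ge0 ?sqr_ge0 // !exprMn ler_wpM2l ?sqr_ge0 //.
by rewrite !exprVn lef_pV2 ?posrE ?exprn_gt0 // b2.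
Qed.

(** The arithmetic-geometric inequality is used twice: in the exponent for the product of the forms,
    then as [expR ((r + s) / 2) <= (expR r + expR s) / 2]. The constant [2] is preserved. *)
Lemma subgaussian_product Z v1 c1 v2 c2 (a b : R) : measurable_fun setT Z ->
  subgaussian_vec P Z K -> 0 < a -> 0 < b ->
  dotv v1 v1 + c1 ^+ 2 <= a ^+ 2 -> dotv v2 v2 + c2 ^+ 2 <= b ^+ 2 ->
  subexponential P (K ^+ 2 * a * b) (fun w => lin_form v1 c1 (Z w) * lin_form v2 c2 (Z w)).
Proof.
move=> mZ sZ a0 b0 va vb.
have mL v c : measurable_fun setT (fun w => lin_form v c (Z w)).
  exact: measurableT_comp (measurable_lin_form v c) mZ.
split; first exact: measurable_funM.
have e1 := subgaussian_lin_form mZ sZ a0 va; have e2 := subgaussian_lin_form mZ sZ b0 vb.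
pose e v c (a : R) w := expR ((lin_form v c (Z w) / a) ^+ 2 / K ^+ 2).
have me v c a' : measurable_fun setT (e v c a').
  apply: (measurable_expR_comp (W := fun w => (lin_form v c (Z w) / a') ^+ 2 / K ^+ 2)).
  apply: measurable_funM => //; apply: measurable_funX.
  exact: measurable_funM.
apply: le_trans (_ : \int[P]_w ((2^-1)%:E * ((e v1 c1 a w)%:E + (e v2 c2 b w)%:E)) <= _)%E.
  apply: ge0_le_integral => //.
  - apply/measurable_EFinP.
    apply: (measurable_expR_comp (W := fun w => `|lin_form v1 c1 (Z w) * lin_form v2 c2 (Z w)|
        / (K ^+ 2 * a * b))).
    by apply: measurable_funM => //; apply: measurableT_comp => //; exact: measurable_funM.
  - by apply: measurable_funeM; apply: emeasurable_funD; exact/measurable_EFinP.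
  - move=> w _; rewrite -EFinD -EFinM lee_fin /e.
    move: (lin_form v1 c1 (Z w)) (lin_form v2 c2 (Z w)) => x y.
    set r := (x / a) ^+ 2 / K ^+ 2; set s := (y / b) ^+ 2 / K ^+ 2.
    apply: le_trans (_ : expR ((r + s) / 2) <= _).
      rewrite ler_expR /r /s -mulrDl normrM.
      have -> : `|x| * `|y| / (K ^+ 2 * a * b) = (2 * (`|x| / a) * (`|y| / b)) / K ^+ 2 / 2.
        by field; rewrite ?gt_eqF //.
      rewrite !ler_pM2r ?invr_gt0 ?exprn_gt0 //.
      rewrite !exprMn -(real_normK (num_real x)) -(real_normK (num_real y)) -!exprMn.
      have := sqr_ge0 (`|x| / a - `|y| / b); rewrite sqrrB; lra.
    have -> : (r + s) / 2 = r / 2 + s / 2 by field.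
    have rr : expR r = expR (r / 2) ^+ 2 by rewrite expr2 -expRD; congr expR; field.
    have ss : expR s = expR (s / 2) ^+ 2 by rewrite expr2 -expRD; congr expR; field.
    rewrite rr ss expRD; have := sqr_ge0 (expR (r / 2) - expR (s / 2)); rewrite sqrrB; lra.
rewrite ge0_integralZl_EFin //; last 2 first.
- by move=> w _; rewrite -EFinD lee_fin addr_ge0 ?expR_ge0.
- by apply: emeasurable_funD; exact/measurable_EFinP.
have e0 v c a' w : (0 <= (e v c a' w)%:E)%E by rewrite lee_fin expR_ge0.
rewrite ge0_integralD //; try exact/measurable_EFinP.
have -> : 2%:E = ((2^-1)%:E * (2%:E + 2%:E))%E :> \bar R.
  by rewrite -EFinD -EFinM; congr EFin; lra.
by apply: lee_wpmul2l; rewrite ?lee_fin // leeD.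
Qed.

End Moments.

(** * Population covariance and population minimizers *)

Section Population.
Context {R : realType} {d : measure_display} {Omega : measurableType d}.
Variable P : probability Omega R.
Variables (p N : nat) (K : R) (Z : 'I_N -> Omega -> p.+1.-tuple R).
Hypotheses (N0 : (0 < N)%N) (K0 : 0 < K) (mZ : forall i, measurable_fun setT (Z i)).
Hypothesis (sZ : forall i, subgaussian_vec P (Z i) K).

Lemma lin_form_product_integrable i v1 c1 v2 c2 :
  P.-integrable setT (EFin \o (fun w => lin_form v1 c1 (Z i w) * lin_form v2 c2 (Z i w))).
Proof.
(* Any positive bound on the coefficient norm will do; this one avoids a square root. *)
pose b (v : 'rV[R]_p) c : R := 1 + dotv v v + c ^+ 2.
have h (v : 'rV[R]_p) c : dotv v v + c ^+ 2 <= b v c ^+ 2.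
  have := dotv_ge0 v; have := sqr_ge0 c; rewrite /b; nra.
have b0 v c : 0 < b v c.
  have := dotv_ge0 v; have := sqr_ge0 c; rewrite /b; lra.
have := subgaussian_product K0 (mZ i) (sZ i) (b0 v1 c1) (b0 v2 c2) (h _ _) (h _ _).
by apply: subexponential_integrable; rewrite !mulr_gt0 // exprn_gt0.
Qed.

Lemma bform_pop_cov u v : bform (pop_cov P Z) u v =
  N%:R^-1 * \sum_i fine 'E_P[fun w => dotv u (xpart (Z i w)) * dotv v (xpart (Z i w))].
Proof.
have iX i (j k : 'I_p) :
    P.-integrable setT (EFin \o (fun w => xpart (Z i w) 0 j * xpart (Z i w) 0 k)).
  have := lin_form_product_integrable i (delta_mx 0 j) 0 (delta_mx 0 k) 0.
  have dE l (z : p.+1.-tuple R) : lin_form (delta_mx 0 l) 0 z = xpart z 0 l.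
    rewrite lin_form0 /dotv (bigD1 l) //= big1 ?addr0 => [|m /negbTE ml].
      by rewrite mxE !eqxx mul1r.
    by rewrite mxE ml andbF mul0r.
  by congr (P.-integrable setT _); apply/funext => w /=; rewrite !dE.
transitivity (N%:R^-1 * \sum_i \sum_j \sum_k (u 0 j * v 0 k) *
   fine 'E_P[fun w => xpart (Z i w) 0 j * xpart (Z i w) 0 k]).
  rewrite bformE mulr_sumr exchange_big /=.
  under [in RHS]eq_bigr do rewrite mulr_sumr.
  rewrite [RHS]exchange_big /= [LHS]exchange_big /=; apply: eq_bigr => j _.
  under [in RHS]eq_bigr do rewrite mulr_sumr.
  rewrite [RHS]exchange_big /=; apply: eq_bigr => k _.
  rewrite mxE -mulrA mulrAC -!mulr_sumr; ring.
congr (_ * _); apply: eq_bigr => i _.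
have -> : (fun w => dotv u (xpart (Z i w)) * dotv v (xpart (Z i w))) =
    (fun w => \sum_j \sum_k (u 0 j * v 0 k) * (xpart (Z i w) 0 j * xpart (Z i w) 0 k)).
  apply/funext => w; rewrite /dotv mulr_suml; apply: eq_bigr => j _.
  by rewrite mulr_sumr; apply: eq_bigr => k _; ring.
have iS (j k : 'I_p) : P.-integrable setT (EFin \o
    (fun w => (u 0 j * v 0 k) * (xpart (Z i w) 0 j * xpart (Z i w) 0 k))).
  by have := integrableZl measurableT (u 0 j * v 0 k) (iX i j k).
rewrite fine_expectation_sum => [|j].
  apply: eq_bigr => j _; rewrite fine_expectation_sum //.
  by apply: eq_bigr => k _; rewrite fine_expectationZ.
rewrite (_ : _ \o _ = fun w => (\sum_k (u 0 j * v 0 k *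
    (xpart (Z i w) 0 j * xpart (Z i w) 0 k))%:E)%E); last first.
  by apply/funext => w /=; rewrite sumEFin.
apply: (@integrable_sum _ _ _ P _ measurableT _ _ _ (fun k w => (u 0 j * v 0 k *
    (xpart (Z i w) 0 j * xpart (Z i w) 0 k))%:E)) => k _; exact: iS.
Qed.

Lemma tr_pop_cov : (pop_cov P Z)^T = pop_cov P Z.
Proof.
apply/matrixP => j k; rewrite !mxE; congr (_ * _); apply: eq_bigr => i _.
by congr (fine (expectation P _)); apply/funext => w; rewrite mulrC.
Qed.

Lemma pop_lossE (th : 'rV[R]_p) : pop_loss P Z th =
  (\sum_i fine 'E_P[fun w => lin_form (- th) 1 (Z i w) * lin_form (- th) 1 (Z i w)])%:E.
Proof.
rewrite -sumEFin; apply: eq_bigr => i _.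
have iL := lin_form_product_integrable i (- th) 1 (- th) 1.
rewrite fineK; last by rewrite unlock; exact: integrable_fin_num iL.
by congr (expectation P _); apply/funext => w; rewrite lin_form_residual -expr2.
Qed.

Variable th0 : 'rV[R]_p.
Hypothesis min0 : forall th, (pop_loss P Z th0 <= pop_loss P Z th)%E.

(** First-order condition without differentiation: along [v] the loss increment is
    [t ^+ 2 * c - 2 * t * b], nonnegative for every [t], which forces [b = 0]. *)
Lemma pop_gradient0 v :
  \sum_i fine 'E_P[fun w => lin_form v 0 (Z i w) * lin_form (- th0) 1 (Z i w)] = 0.
Proof.
set b := \sum_i _.
pose c := \sum_i fine 'E_P[fun w => lin_form v 0 (Z i w) * lin_form v 0 (Z i w)].
suff : b ^+ 2 <= 0 * c by rewrite mul0r => h; apply/eqP; rewrite -sqrf_eq0 eq_le h sqr_ge0.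
apply: quadratic_disc => //; last first.
  apply: sumr_ge0 => i _; rewrite fine_ge0 // expectation_ge0 // => w.
  by rewrite -expr2 sqr_ge0.
move=> t; have := min0 (th0 + t *: v).
rewrite !pop_lossE lee_fin -subr_ge0.
have -> : \sum_i fine 'E_P[fun w => lin_form (- (th0 + t *: v)) 1 (Z i w) *
     lin_form (- (th0 + t *: v)) 1 (Z i w)] =
   \sum_i fine 'E_P[fun w => lin_form (- th0) 1 (Z i w) * lin_form (- th0) 1 (Z i w)]
   + (- (2 * t)) * b + t ^+ 2 * c.
  rewrite /b /c !mulr_sumr -!big_split /=; apply: eq_bigr => i _.
  have i1 := lin_form_product_integrable i (- th0) 1 (- th0) 1.
  have i2 := lin_form_product_integrable i v 0 (- th0) 1.
  have i3 := lin_form_product_integrable i v 0 v 0.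
  have i2' := integrableZl measurableT (- (2 * t)) i2.
  have i3' := integrableZl measurableT (t ^+ 2) i3.
  rewrite -!fine_expectationZ // -!fine_expectationD //; last exact: integrableD i1 i2'.
  congr (fine (expectation P _)); apply/funext => w.
  rewrite /lin_form !dotvNl dotvDl dotvZl; ring.
by congr (0 <= _); ring.
Qed.

(** Since [(th0.x)^2 <= 2 y^2 + 2 (y - th0.x)^2] and the loss at [th0] is at most the loss at [0],
    the quadratic form at [th0] is at most four times the average of [E[y^2] <= 2 K^2]. *)
Lemma pop_minimizer_bound (cS : R) : 0 < cS -> cS^-1 <= lambda_min (pop_cov P Z) ->
  dotv th0 th0 <= 8 * K ^+ 2 * cS.
Proof.
move=> c0 hc.
have Np : 0 < N%:R :> R by rewrite ltr0n.
have := lambda_min_le_bform th0 tr_pop_cov.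
have : cS^-1 * dotv th0 th0 <= lambda_min (pop_cov P Z) * dotv th0 th0.
  by rewrite ler_wpM2r // dotv_ge0.
move=> /le_trans /[apply]; rewrite mulrC ler_pdivrMr // => h; apply: le_trans h _.
rewrite ler_pM2r // bform_pop_cov mulrC ler_pdivrMr //.
have sq i : subexponential P (K ^+ 2 * 1 * 1)
    (fun w => lin_form 0 1 (Z i w) * lin_form 0 1 (Z i w)).
  by apply: subgaussian_product => //; rewrite dotv0l add0r !expr1n.
have k0 : 0 < K ^+ 2 * 1 * 1 by rewrite !mulr1 exprn_gt0.
have y2 : \sum_i fine 'E_P[fun w => lin_form 0 1 (Z i w) * lin_form 0 1 (Z i w)]
    <= N%:R * (2 * K ^+ 2).
  rewrite mulr_natl -[N in _ *+ N]card_ord -sumr_const; apply: ler_sum => i _.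
  by have := subexponential_expectation_le k0 (sq i); rewrite !mulr1.
have := min0 0; rewrite !pop_lossE lee_fin oppr0 => m0.
apply: le_trans (_ : \sum_i (2 * fine 'E_P[fun w => lin_form 0 1 (Z i w) * lin_form 0 1 (Z i w)]
   + 2 * fine 'E_P[fun w => lin_form (- th0) 1 (Z i w) * lin_form (- th0) 1 (Z i w)]) <= _).
  apply: ler_sum => i _.
  have i1 := lin_form_product_integrable i (- th0) 1 (- th0) 1.
  have i2 := lin_form_product_integrable i 0 1 0 1.
  have i3 := lin_form_product_integrable i th0 0 th0 0.
  have i1' := integrableZl measurableT 2 i1.
  have i2' := integrableZl measurableT 2 i2.
  rewrite -!fine_expectationZ // -!fine_expectationD //.
  apply: fine_expectation_le => [||w].
  - move: i3; congr (P.-integrable setT _); apply/funext => w /=.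
    by rewrite !lin_form0.
  - exact: integrableD i2' i1'.
  rewrite /lin_form dotvNl dotv0l.
  have := sqr_ge0 (2 * ypart (Z i w) - dotv th0 (xpart (Z i w))); rewrite expr2; lra.
rewrite big_split /= -!mulr_sumr; lra.
Qed.

End Population.

(** * The GradDiff estimator *)

Section EmpiricalLoss.
Context {R : realType} {p : nat} {I : finType}.
Implicit Types (z : I -> p.+1.-tuple R) (A : {set I}) (th u v : 'rV[R]_p) (n : nat).

(** The divisor [n] is separate from the size of [A] because the objective divides by [ntr] whatever
    subset is drawn. *)
Definition emp_cov n A z : 'M[R]_p :=
  n%:R^-1 *: \sum_(i in A) ((xpart (z i))^T *m xpart (z i)).

(** Minus half the gradient of the normalized empirical loss. *)
Definition emp_score n A z th : 'rV[R]_p :=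
  n%:R^-1 *: \sum_(i in A) lin_form (- th) 1 (z i) *: xpart (z i).

Lemma bform_emp_cov n A z u v : bform (emp_cov n A z) u v =
  n%:R^-1 * \sum_(i in A) lin_form u 0 (z i) * lin_form v 0 (z i).
Proof.
rewrite bform_mxZ; congr (_ * _); rewrite /bform mulmx_sumr dotvC dotv_sumr.
apply: eq_bigr => i _; rewrite !lin_form0 mulmxA.
rewrite (_ : u *m (xpart (z i))^T = (dotv u (xpart (z i)))%:M).
  by rewrite mul_scalar_mx dotvZr.
apply/matrixP => a b; rewrite !ord1 !mxE eqxx mulr1n.
by apply: eq_bigr => j _; rewrite [in LHS]mxE.
Qed.

Lemma tr_emp_cov n A z : (emp_cov n A z)^T = emp_cov n A z.
Proof.
rewrite /emp_cov linearZ /= linear_sum /=; congr (_ *: _); apply: eq_bigr => i _.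
by rewrite trmx_mul trmxK.
Qed.

Lemma dotv_emp_score n A z th u : dotv u (emp_score n A z th) =
  n%:R^-1 * \sum_(i in A) lin_form u 0 (z i) * lin_form (- th) 1 (z i).
Proof.
rewrite dotvZr dotv_sumr; congr (_ * _); apply: eq_bigr => i _.
by rewrite dotvZr lin_form0 mulrC.
Qed.

Lemma emp_cov_psd n A z u : 0 <= bform (emp_cov n A z) u u.
Proof.
rewrite bform_emp_cov mulr_ge0 ?invr_ge0 ?ler0n // sumr_ge0 // => i _.
by rewrite -expr2 sqr_ge0.
Qed.

Lemma emp_score_shift n A z th th' :
  emp_score n A z th = emp_score n A z th' + (th' - th) *m emp_cov n A z.
Proof.
rewrite /emp_score /emp_cov -scalemxAr -scalerDr mulmx_sumr -big_split /=.
congr (_ *: _); apply: eq_bigr => i _; rewrite mulmxA.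
rewrite (_ : (th' - th) *m (xpart (z i))^T = (dotv (th' - th) (xpart (z i)))%:M).
  rewrite mul_scalar_mx -scalerDl /lin_form !dotvNl dotvBl; congr (_ *: _); ring.
apply/matrixP => a b; rewrite !ord1 !mxE eqxx mulr1n.
by apply: eq_bigr => j _; rewrite !mxE.
Qed.

Lemma emp_loss_expand n A z th h :
  n%:R^-1 * \sum_(i in A) sqloss (th + h) (z i) =
  n%:R^-1 * (\sum_(i in A) sqloss th (z i)) + bform (emp_cov n A z) h h
    - 2 * dotv h (emp_score n A z th).
Proof.
rewrite bform_emp_cov dotv_emp_score mulrCA -!mulrDr -mulrBr; congr (_ * _).
rewrite mulr_sumr -sumrN -!big_split /=; apply: eq_bigr => i _.
rewrite /sqloss /lin_form !dotvNl dotvDr (dotvC (xpart _) th) (dotvC (xpart _) h); ring.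
Qed.

(** Cauchy-Schwarz for [G] at [u] and [w = u *m G] gives [|w|^4 <= L |u|^2 * L |w|^2]. *)
Lemma psd_mulmx_norm2_le (G : 'M[R]_p) (L : R) u : G^T = G -> 0 <= L ->
  (forall v, 0 <= bform G v v) -> (forall v, bform G v v <= L * dotv v v) ->
  norm2 (u *m G) <= L * norm2 u.
Proof.
move=> sG L0 G0 GL; set w := u *m G.
have [->|w0] := eqVneq (norm2 w) 0; first by rewrite mulr_ge0 ?norm2_ge0.
have wp : 0 < norm2 w by rewrite lt_neqAle eq_sym w0 norm2_ge0.
have := bform_CauchySchwarz u w sG G0.
have -> : bform G u w = norm2 w ^+ 2 by rewrite norm2_sqr.
have h : bform G u u * bform G w w <= (L * norm2 u ^+ 2) * (L * norm2 w ^+ 2).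
  by rewrite !norm2_sqr ler_pM.
move=> /le_trans /(_ h); rewrite (_ : L * _ * _ = (L * norm2 u * norm2 w) ^+ 2); last by ring.
rewrite ler_pXn2r ?nnegrE ?mulr_ge0 ?norm2_ge0 ?sqr_ge0 //.
by rewrite expr2 ler_pM2r.
Qed.

End EmpiricalLoss.

Section GradDiff.
Context {R : realType} {p Nr Nf : nat}.
Variables (zr : 'I_Nr -> p.+1.-tuple R) (zf : 'I_Nf -> p.+1.-tuple R).
Variables (A : {set 'I_Nr}) (ntr : nat) (Sr Sf : 'M[R]_p) (th_r th_f : 'rV[R]_p).
Variables (cS lr lf tau tr tf lam : R).

Let Gr := emp_cov ntr A zr.
Let Gf := emp_cov Nf [set: 'I_Nf]%SET zf.
Let obj th := - (Nf%:R^-1 * \sum_(i < Nf) sqloss th (zf i))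
  + lam / ntr%:R * \sum_(i in A) sqloss th (zr i).

(* The Hessian [lam Gr - Gf] retains a quarter of [lam * lr]: half of it is spent on [lf],
   and [tau] is negligible because [lam * cS ^+ 2 >= 2]. *)
Lemma graddiff_deterministic :
  1 < cS -> cS^-1 <= lr <= cS -> cS^-1 <= lf <= cS -> 6 * cS ^+ 3 * tau <= 1 -> 0 <= tau ->
  2 * lf / lr <= lam ->
  (forall u, lr * dotv u u <= bform Sr u u) -> (forall u, bform Sf u u <= lf * dotv u u) ->
  (forall u, `|bform (Gr - Sr) u u| <= tau * dotv u u) ->
  (forall u, `|bform (Gf - Sf) u u| <= tau * dotv u u) ->
  norm2 (emp_score ntr A zr th_r) <= tr ->
  norm2 (emp_score Nf [set: 'I_Nf]%SET zf th_f) <= tf ->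
  (exists th, is_argmin obj th) /\
  forall th, is_argmin obj th ->
    norm2 (th - th_r) <= 8 * cS * (tr + (tf + (cS + 1) * norm2 (th_r - th_f)) / lam).
Proof.
move=> cS1 /andP[clr lrc] /andP[clf lfc] tauc tau0 lamg Srl Sfl dr df sr sf.
have cS0 : 0 < cS by lra.
have cSi : 0 < cS^-1 by rewrite invr_gt0.
have lr0 : 0 < lr by apply: lt_le_trans clr.
have lf0 : 0 < lf by apply: lt_le_trans clf.
have lam0 : 0 < lam by apply: lt_le_trans lamg; rewrite divr_gt0 // mulr_gt0.
have lamlr : 2 * lf <= lam * lr by rewrite -ler_pdivrMr.
have clr1 : 1 <= cS * lr by rewrite -ler_pdivrMl // mulr1.
have clf1 : 1 <= cS * lf by rewrite -ler_pdivrMl // mulr1.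
have lamc : 2 <= lam * cS ^+ 2.
  have : lam * lr * cS <= lam * cS * cS by rewrite ler_pM2r // ler_pM2l.
  have : 2 * lf * cS <= lam * lr * cS by rewrite ler_pM2r.
  by rewrite expr2; lra.
have cS2 : 1 <= cS ^+ 2 by rewrite exprn_ege1 // ltW.
have ctau0 : 0 <= cS ^+ 2 * tau by rewrite mulr_ge0 // sqr_ge0.
have tau6 : 6 * (cS ^+ 2 * tau) <= lr.
  by rewrite -(ler_pM2l cS0); apply: le_trans clr1; rewrite exprS in tauc; lra.
have tauc2 : tau <= cS ^+ 2 * tau by rewrite ler_peMl.
have tau1 : tau <= 1.
  have : cS ^+ 2 * tau <= cS * (cS ^+ 2 * tau) by rewrite ler_peMl // ltW.
  by rewrite exprS in tauc; lra.
have Grl u : (lr - tau) * dotv u u <= bform Gr u u.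
  have := dr u; rewrite bform_mxB ler_norml => /andP[h _]; have := Srl u; lra.
have Gfl u : bform Gf u u <= (lf + tau) * dotv u u.
  have := df u; rewrite bform_mxB ler_norml => /andP[_ h]; have := Sfl u; lra.
pose H := lam *: Gr - Gf.
have Hm u : lam * lr / 4 * dotv u u <= bform H u u.
  rewrite bform_mxB bform_mxZ.
  have := ler_wpM2l (ltW lam0) (Grl u); have := Gfl u; have q := dotv_ge0 u.
  (* Here [lam * tau <= lam * lr / 6] and [tau <= lam * lr / 12] add up to the available quarter;
     this fixes the factor [6] in the hypothesis on [tau]. *)
  have c : 0 <= (lam * (lr - tau) - (lf + tau) - lam * lr / 4) * dotv u u.
    rewrite mulr_ge0 //.
    have : lam * (6 * (cS ^+ 2 * tau)) <= lam * lr by rewrite ler_wpM2l // ltW.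
    have : 2 * tau <= lam * cS ^+ 2 * tau by rewrite ler_wpM2r.
    have : lam * tau <= lam * (cS ^+ 2 * tau) by rewrite ler_wpM2l // ltW.
    lra.
  lra.
have sH : H^T = H by rewrite /H linearB /= linearZ /= !tr_emp_cov.
pose gr := emp_score ntr A zr th_r; pose gf := emp_score Nf [set: 'I_Nf]%SET zf th_r.
have m0 : 0 < lam * lr / 4 by rewrite divr_gt0 // mulr_gt0.
have objE h : obj (th_r + h) = obj th_r + bform H h h - 2 * dotv (lam *: gr - gf) h.
  have sumT th : \sum_(i < Nf) sqloss th (zf i) = \sum_(i in [set: 'I_Nf]%SET) sqloss th (zf i).
    by apply: eq_bigl => i; rewrite finset.in_setT.
  rewrite /obj -!(mulrA lam) !sumT !emp_loss_expand -/Gr -/Gf -/gr -/gf.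
  rewrite bform_mxB bform_mxZ dotvBl dotvZl (dotvC gr) (dotvC gf).
  move: (bform Gr h h) (bform Gf h h) (dotv h gr) (dotv h gf) => a b c e; ring.
have [ex bd] := argmin_quadratic sH m0 Hm objE.
split => // th /bd le1; apply: le_trans le1 _.
have ngf : norm2 gf <= tf + (cS + 1) * norm2 (th_r - th_f).
  rewrite /gf (emp_score_shift _ _ _ th_r th_f); apply: le_trans (norm2D _ _) _.
  apply: lerD => //; rewrite -(norm2N (th_r - th_f)) opprB.
  apply: le_trans (psd_mulmx_norm2_le _ (tr_emp_cov _ _ _) _ (emp_cov_psd _ _ _) Gfl) _.
    lra.
  by rewrite ler_wpM2r ?norm2_ge0 //; lra.
have ng : norm2 (lam *: gr - gf) <= lam * tr + (tf + (cS + 1) * norm2 (th_r - th_f)).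
  apply: le_trans (norm2D _ _) _; rewrite norm2N norm2Z (ger0_norm (ltW lam0)).
  by apply: lerD => //; rewrite ler_wpM2l // ltW.
rewrite ler_pdivrMr //.
apply: le_trans (_ : 2 * (lam * tr + (tf + (cS + 1) * norm2 (th_r - th_f))) <= _).
  by rewrite ler_wpM2l.
(* Replacing [1 / lr] by [cS] loses only the factor [cS * lr >= 1]. *)
set X := tf + _; have -> : 8 * cS * (tr + X / lam) * (lam * lr / 4) =
    (cS * lr) * (2 * (lam * tr + X)) by field; rewrite gt_eqF.
rewrite ler_peMl // mulr_ge0 //.
by apply: le_trans ng; exact: norm2_ge0.
Qed.

End GradDiff.

(** * Uniform deviations over a finite family of functions *)

Section Deviations.
Context {R : realType} {d : measure_display} {Omega : measurableType d}.
Variable P : probability Omega R.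

Lemma union_bound (V : eqType) (s : seq V) (F : V -> set Omega) (e : R) :
  (forall v, v \in s -> measurable (F v)) -> (forall v, v \in s -> (P (F v) <= e%:E)%E) ->
  exists U, [/\ measurable U, (P U <= ((size s)%:R * e)%:E)%E &
    forall v, v \in s -> F v `<=` U].
Proof.
elim: s => [_ _|v s IH mF PF].
  by exists set0; split => //; rewrite measure0 mul0r.
have [u us|u us|U [mU PU FU]] := IH; first by apply: mF; rewrite inE us orbT.
  by apply: PF; rewrite inE us orbT.
have mv : measurable (F v) by apply: mF; rewrite inE eqxx.
exists (F v `|` U); split; first exact: measurableU.
  have h := measureU2 P mv mU; apply: le_trans h _.
  rewrite /= -natr1 mulrDl mul1r addrC EFinD; apply: leeD => //.
  by apply: PF; rewrite inE eqxx.
move=> u; rewrite inE => /orP[/eqP ->|us]; first exact: subsetUl.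
by apply: subset_trans (FU _ us) _; exact: subsetUr.
Qed.

Lemma uniform_deviation (V : eqType) (s : seq V) (D : set Omega) (Y : V -> Omega -> R)
    (mu : V -> R) (n : nat) (kappa t : R) :
  measurable D -> (forall v, measurable_fun setT (Y v)) -> (0 < n)%N -> 0 < kappa ->
  0 <= t <= 32 * kappa ->
  (forall v l, v \in s -> `|l| * kappa <= 2^-1 ->
     (\int[P]_w (expR (l * Y v w) * \1_D w)%:E <=
     (expR (n%:R * (l * mu v + 32 * l ^+ 2 * kappa ^+ 2)))%:E)%E) ->
  exists U, [/\ measurable U,
    (P U <= ((size s)%:R * (2 * expR (- (n%:R * t ^+ 2 / (128 * kappa ^+ 2)))))%:E)%E &
    forall v w, v \in s -> D w -> ~ U w -> `|n%:R^-1 * Y v w - mu v| <= t].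
Proof.
move=> mD mY n0 k0 tk H.
pose F v := D `&` [set w | (t < `|n%:R^-1 * Y v w - mu v|)%R].
have mF v : measurable (F v).
  have mf : measurable_fun setT (fun w => `|n%:R^-1 * Y v w - mu v|).
    apply: measurableT_comp => //; apply: measurable_funB => //.
    exact: measurable_funM.
  apply: measurableI => //.
  rewrite (_ : [set _ | _] = (fun w => `|n%:R^-1 * Y v w - mu v|) @^-1` `]t, +oo[%classic).
    by rewrite -[X in measurable X]setTI; apply: mf => //; exact: measurable_itv.
  by apply/seteqP; split => w /=; rewrite in_itv /= andbT.
have [v _|v vs|U [mU PU FU]] := @union_bound _ s F
    (2 * expR (- (n%:R * t ^+ 2 / (128 * kappa ^+ 2)))) => //.
  by apply: chernoff_average => // l; exact: H.
exists U; split => // v w vs Dw nU; rewrite leNgt; apply/negP => h.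
by apply: nU; apply: FU vs _ _.
Qed.

Variables (p N : nat) (Z : 'I_N -> Omega -> p.+1.-tuple R) (V : eqType) (s : seq V)
  (g : V -> p.+1.-tuple R -> R) (kappa t : R).
Hypotheses (k0 : 0 < kappa) (tk : 0 <= t <= 32 * kappa)
  (mZ : forall i, measurable_fun setT (Z i)) (mg : forall v, measurable_fun setT (g v))
  (sg : forall v i, v \in s -> subexponential P kappa (fun w => g v (Z i w))).

Let mgZ v i : measurable_fun setT (fun w => g v (Z i w)).
Proof. exact: measurableT_comp (mg v) (mZ i). Qed.

Let gen_events_comp v i B : measurable B -> gen_events (Z i) ((fun w => g v (Z i w)) @^-1` B).
Proof.
move=> mB; exists (g v @^-1` B) => //=.
by rewrite -[X in measurable X]setTI; exact: mg.
Qed.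

Let gen_events_measurable i (A : set Omega) : gen_events (Z i) A -> measurable A.
Proof. by move=> [B mB <-]; rewrite -[X in measurable X]setTI; exact: mZ. Qed.

Lemma full_sample_deviation : (0 < N)%N ->
  mutually_independent P (fun i => gen_events (Z i)) ->
  exists U, [/\ measurable U,
    (P U <= ((size s)%:R * (2 * expR (- (N%:R * t ^+ 2 / (128 * kappa ^+ 2)))))%:E)%E &
    forall v w, v \in s -> ~ U w -> `|N%:R^-1 * (\sum_i g v (Z i w))
       - N%:R^-1 * \sum_i fine 'E_P[fun w => g v (Z i w)]| <= t].
Proof.
move=> N0 indZ.
have [v||U [mU PU hU]] := @uniform_deviation _ s setT (fun v w => \sum_i g v (Z i w))
  (fun v => N%:R^-1 * \sum_i fine 'E_P[fun w => g v (Z i w)]) _ _ t measurableT _ N0 k0 tk.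
- exact: measurable_sum.
- move=> v l vs lk; apply: (mgf_full_sum (E := fun i => gen_events (Z i))) => //.
  + by move=> i B; exact: gen_events_comp.
  + by move=> i; exact: sg.
by exists U; split => // v w vs; exact: hU.
Qed.

Variables (n : nat) (S : Omega -> {set 'I_N}).
Hypotheses (n0 : (0 < n)%N) (nN : (n <= N)%N)
  (mS : forall B : set {set 'I_N}, measurable (S @^-1` B))
  (PS : forall A : {set 'I_N}, #|A| = n -> P [set w | S w = A] = (('C(N, n))%:R^-1)%:E).

Lemma measurable_card_subset : measurable [set w | #|S w| = n].
Proof. by rewrite (_ : [set w | _] = S @^-1` [set A : {set 'I_N} | #|A| = n]). Qed.

(** The ['C(N, n)] subsets of size [n] already exhaust the total mass. *)
Lemma probability_card_subset : P [set w | #|S w| = n] = 1%E.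
Proof.
pose T := [set A : {set 'I_N} | #|A| == n]%SET.
rewrite -[X in P X]setIT -integral_indic //; last exact: measurable_card_subset.
transitivity (\int[P]_w (\sum_(A <- enum T) (\1_(S @^-1` [set A]) w)%:E))%E.
  apply: eq_integral => w _; rewrite big_enum /= sumEFin; congr EFin.
  have SE A : \1_(S @^-1` [set A]) w = (S w == A)%:R :> R.
    by rewrite indicE; case: eqP => h; [rewrite mem_set | rewrite memNset].
  under eq_bigr do rewrite SE.
  rewrite indicE; have [/eqP Sn|Sn] := boolP (#|S w| == n).
    rewrite mem_set // (bigD1 (S w)) ?inE ?Sn //= eqxx big1 ?addr0 //.
    by move=> A /andP[_ /negbTE]; rewrite eq_sym => ->.
  rewrite memNset ?big1 //; last by move=> /= h; rewrite h eqxx in Sn.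
  move=> A; rewrite inE => /eqP An; case: eqP => // h.
  by rewrite h An eqxx in Sn.
rewrite ge0_integral_sum //; last first.
  by move=> A; exact/measurable_EFinP/measurable_indic/mS.
rewrite big_enum /=.
transitivity (\sum_(A in T) (('C(N, n))%:R^-1)%:E : \bar R)%E.
  apply: eq_bigr => A; rewrite inE => /eqP An.
  by rewrite integral_indic ?setIT //; exact: PS.
rewrite sumEFin sumr_const card_draws card_ord -[_ *+ _]mulr_natl divff //.
by rewrite pnatr_eq0 -lt0n bin_gt0.
Qed.

Lemma random_subset_deviation (E : option 'I_N -> set (set Omega)) :
  mutually_independent P E ->
  E None = gen_events_discrete S -> (forall i, E (Some i) = gen_events (Z i)) ->
  exists U, [/\ measurable U,
    (P U <= ((size s)%:R * (2 * expR (- (n%:R * t ^+ 2 / (128 * kappa ^+ 2)))))%:E)%E &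
    forall v w, v \in s -> #|S w| = n -> ~ U w ->
      `|n%:R^-1 * (\sum_(i in S w) g v (Z i w))
       - N%:R^-1 * \sum_i fine 'E_P[fun w => g v (Z i w)]| <= t].
Proof.
move=> indE EN ES.
have [v||U [mU PU hU]] := @uniform_deviation _ s [set w | #|S w| = n]
  (fun v w => \sum_(i in S w) g v (Z i w))
  (fun v => N%:R^-1 * \sum_i fine 'E_P[fun w => g v (Z i w)]) _ _ t
  measurable_card_subset _ n0 k0 tk.
(* Indicators of membership turn the random index set into a fixed one, which gives
   measurability. *)
- rewrite (_ : (fun w => _) = (fun w =>
      \sum_i \1_(S @^-1` [set A : {set 'I_N} | i \in A]) w * g v (Z i w))); last first.
    apply/funext => w; rewrite big_mkcond /=; apply: eq_bigr => i _; rewrite indicE.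
    by case: ifPn => h; [rewrite mem_set // mul1r | rewrite memNset ?mul0r //; exact/negP].
  by apply: measurable_sum => i; apply: measurable_funM => //; exact/measurable_indic/mS.
- move=> v l vs lk; apply: (mgf_random_subset (E := E)) => //.
  + case=> [i|] A; first by rewrite ES; exact: gen_events_measurable.
    by rewrite EN => -[B _ <-]; exact: mS.
  + by move=> B; rewrite EN; exists B.
  + by move=> i B; rewrite ES; exact: gen_events_comp.
  + by move=> i; exact: sg.
by exists U; split => // v w vs; exact: hU.
Qed.

End Deviations.

(** * Explicit constants and the high-probability event *)

Section Assembly.
Context {R : realType}.

Lemma net_to_sample (p n : nat) (I : finType) (z : I -> p.+1.-tuple R) (A : {set I})
    (Sigma : 'M[R]_p) (th : 'rV[R]_p) (s : seq 'rV[R]_p) (t : R) :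
  Sigma^T = Sigma -> 0 <= t -> (forall v, v \in s -> norm2 v <= 1) ->
  (forall u, norm2 u <= 1 -> exists2 v, v \in s & norm2 (u - v) <= 4^-1) ->
  (forall v, v \in s -> `|n%:R^-1 * (\sum_(i in A) lin_form v 0 (z i) * lin_form v 0 (z i))
     - bform Sigma v v| <= t) ->
  (forall v, v \in s ->
     `|n%:R^-1 * (\sum_(i in A) lin_form v 0 (z i) * lin_form (- th) 1 (z i))| <= t) ->
  (forall u, `|bform (emp_cov n A z - Sigma) u u| <= 2 * t * dotv u u) /\
  norm2 (emp_score n A z th) <= 2 * t.
Proof.
move=> sS t0 s1 net hc hs; split.
  apply: (bform_le_net _ s1 net) => [|v vs].
    by rewrite linearB /= tr_emp_cov sS.
  by rewrite bform_mxB bform_emp_cov; exact: hc.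
apply: (norm2_le_net net) => // v vs.
by rewrite dotv_emp_score; exact: le_trans (ler_norm _) (hs v vs).
Qed.

(* [54 ^ 2 / 128 > 22 = 18 + 3 + 1]: the net costs [18 p] and the numerical factors [3 p]. *)
Lemma net_tail_le (p n m : nat) (kappa t : R) : (0 < p)%N -> (0 < n)%N -> 0 < kappa ->
  t = 54 * kappa * Num.sqrt (p%:R / n%:R) -> (m <= 2 * 2 ^ (18 * p))%N ->
  m%:R * (2 * expR (- (n%:R * t ^+ 2 / (128 * kappa ^+ 2)))) <= expR (- p%:R) / 2.
Proof.
move=> p0 n0 k0 tE mp.
have np : 0 < n%:R :> R by rewrite ltr0n.
have kn : kappa != 0 by rewrite gt_eqF.
have -> : n%:R * t ^+ 2 / (128 * kappa ^+ 2) = 2916 / 128 * p%:R.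
  rewrite tE !exprMn sqr_sqrtr ?divr_ge0 ?ler0n //; field.
  by rewrite kn gt_eqF.
have p1 : 1 <= p%:R :> R by rewrite ler1n.
have e2 : 2 <= expR 1 :> R by have := @expR_ge1Dx R 1; lra.
have h22 : expR (- (2916 / 128 * p%:R)) <= expR (- (22%:R * p%:R)) :> R.
  by rewrite ler_expR; lra.
have h : (8 * m%:R : R) <= 2 * expR (21%:R * p%:R).
  apply: le_trans (_ : 8 * (2 * 2 ^+ (18 * p)) <= _).
    by rewrite ler_pM2l // -natrX -natrM ler_nat.
  rewrite mulrCA ler_pM2l // (_ : 8 = 2 ^+ 3 :> R); last by rewrite !exprS expr0; lra.
  have -> : expR (21%:R * p%:R) = expR 1 ^+ (21 * p) :> R.
    by rewrite -natrM -[X in expR X]mulr1 expRM_natl.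
  rewrite -exprD.
  apply: le_trans (_ : 2 ^+ (21 * p) <= _).
    have p3 : (3 + 18 * p <= 21 * p)%N.
      by rewrite -[21%N]/(3 + 18)%N mulnDl leq_add2r leq_pmulr.
    by apply: ler_weXn2l; rewrite // ler1n.
  by rewrite lerXn2r // ?nnegrE ?expR_ge0.
apply: le_trans (_ : m%:R * (2 * expR (- (22%:R * p%:R))) <= _).
  by rewrite ler_wpM2l ?ler0n // ler_pM2l.
have -> : expR (- p%:R) = expR (21%:R * p%:R) * expR (- (22%:R * p%:R)) :> R.
  by rewrite -expRD; congr expR; ring.
have := ler_wpM2r (expR_ge0 (- (22%:R * p%:R))) h; lra.
Qed.

Lemma lambda_min_le_max (p : nat) (A : 'M[R]_p) : (0 < p)%N -> A^T = A ->
  lambda_min A <= lambda_max A.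
Proof.
case: p A => // p A _ sA; pose u : 'rV[R]_p.+1 := delta_mx 0 ord0.
have u1 : dotv u u = 1.
  rewrite /dotv (bigD1 ord0) //= big1 ?addr0 => [|j /negbTE j0]; rewrite !mxE !eqxx.
    by rewrite mul1r.
  by rewrite j0 andbF mul0r.
have := le_trans (lambda_min_le_bform u sA) (bform_le_lambda_max u sA).
by rewrite u1 !mulr1.
Qed.

Variables (cS K : R) (p Nr Nf ntr : nat) (d : measure_display) (Omega : measurableType d)
  (P : probability Omega R) (Zr : 'I_Nr -> Omega -> p.+1.-tuple R)
  (Zf : 'I_Nf -> Omega -> p.+1.-tuple R) (S : Omega -> {set 'I_Nr})
  (theta_r theta_f : 'rV[R]_p).

(* [resid_norm] bounds the Euclidean norm of the coefficients [(- th, 1)] of a residual, where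
   [th] is a population minimizer. *)
Definition resid_norm : R := 1 + 8 * K ^+ 2 * cS.
(** The scale given by [subgaussian_product] for a covariate form of norm at most [1] times a
    residual. *)
Definition tail_scale : R := K ^+ 2 * 1 * resid_norm.
(** Largest allowed [sqrt (p / n)]. The bound [1/2] keeps the deviation level
    [54 * tail_scale * sqrt (p / n)] below [32 * tail_scale]; the other yields
    [6 * cS ^+ 3 * tau <= 1] for [tau = 108 * tail_scale * max_ratio], as [648 = 6 * 108]. *)
Definition max_ratio : R := Num.min 2^-1 (648 * tail_scale * cS ^+ 3)^-1.
Definition rate_const : R := 8 * cS * (108 * tail_scale + cS + 1).

(** The boolean selects second moment or score, so a single union bound over two copies of the net
    handles both. *)
Let g (th : 'rV[R]_p) (x : bool * 'rV[R]_p) (z : p.+1.-tuple R) : R :=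
  lin_form x.2 0 z * (if x.1 then lin_form x.2 0 z else lin_form (- th) 1 z).

Let measurable_g th x : measurable_fun setT (g th x).
Proof.
apply: measurable_funM; first exact: measurable_lin_form.
by case: x => -[] v; exact: measurable_lin_form.
Qed.

Hypotheses (cS1 : 1 < cS) (K0 : 0 < K).

Let cS0 : 0 < cS. Proof. exact: lt_trans ltr01 cS1. Qed.

Let resid_norm_ge1 : 1 <= resid_norm.
Proof. by rewrite /resid_norm lerDl !mulr_ge0 // ?sqr_ge0 // ltW. Qed.

Lemma tail_scale_gt0 : 0 < tail_scale.
Proof. by rewrite /tail_scale mulr1 mulr_gt0 ?exprn_gt0 // (lt_le_trans _ resid_norm_ge1). Qed.

Let ratio_denominator_gt0 : 0 < 648 * tail_scale * cS ^+ 3.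
Proof. exact: mulr_gt0 (mulr_gt0 (ltr0Sn R 647) tail_scale_gt0) (exprn_gt0 3 cS0). Qed.

Lemma max_ratio_gt0 : 0 < max_ratio.
Proof. by rewrite lt_min !invr_gt0 ratio_denominator_gt0 ltr0Sn. Qed.

Let subexponential_g N (Z : 'I_N -> Omega -> p.+1.-tuple R) th x i :
  measurable_fun setT (Z i) -> subgaussian_vec P (Z i) K ->
  dotv th th <= 8 * K ^+ 2 * cS -> norm2 x.2 <= 1 ->
  subexponential P tail_scale (fun w => g th x (Z i w)).
Proof.
move=> mZ sZ hth x1.
have B1 := resid_norm_ge1.
have Bp : 0 < resid_norm := lt_le_trans ltr01 B1.
(* [resid_norm] bounds the squared coefficient norm [1 + |th|^2]; being at least [1], it also bounds
   the norm. *)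
have B2 : resid_norm <= resid_norm ^+ 2 by rewrite expr2 ler_peMr // ltW.
have x2 : dotv x.2 x.2 <= 1 by rewrite -norm2_sqr expr_le1 // norm2_ge0.
have x2' : dotv x.2 x.2 + 0 ^+ 2 <= 1 ^+ 2 by rewrite expr0n addr0 expr1n.
rewrite /g; case: x.1.
  apply: subgaussian_product => //; rewrite expr0n addr0; apply: le_trans x2 _.
  exact: le_trans B1 B2.
apply: subgaussian_product => //.
by rewrite dotvNl dotvNr opprK expr1n; apply: le_trans B2; rewrite /resid_norm; lra.
Qed.

Hypotheses (p0 : (0 < p)%N) (n0 : (0 < ntr)%N) (nN : (ntr <= Nr)%N) (Nf0 : (0 < Nf)%N)
  (pn : p%:R <= max_ratio ^+ 2 * Num.min ntr%:R Nf%:R)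
  (mZr : forall i, measurable_fun setT (Zr i)) (mZf : forall i, measurable_fun setT (Zf i))
  (mS : forall B : set {set 'I_Nr}, measurable (S @^-1` B))
  (indep : mutually_independent P
      (fun o : option ('I_Nr + 'I_Nf) => match o with
        | None => gen_events_discrete S
        | Some (inl i) => gen_events (Zr i)
        | Some (inr i) => gen_events (Zf i) end))
  (PS : forall A : {set 'I_Nr}, #|A| = ntr ->
       P [set w | S w = A] = (('C(Nr, ntr))%:R^-1)%:E)
  (sZr : forall i, subgaussian_vec P (Zr i) K) (sZf : forall i, subgaussian_vec P (Zf i) K)
  (lrmin : cS^-1 <= lambda_min (pop_cov P Zr)) (lrmax : lambda_max (pop_cov P Zr) <= cS)
  (lfmin : cS^-1 <= lambda_min (pop_cov P Zf)) (lfmax : lambda_max (pop_cov P Zf) <= cS)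
  (min_r : forall theta, (pop_loss P Zr theta_r <= pop_loss P Zr theta)%E)
  (min_f : forall theta, (pop_loss P Zf theta_f <= pop_loss P Zf theta)%E).

(** The event is chosen before [lam], so the data-independent choice of [lam] in the second claim
    needs no new probabilistic argument. *)
Lemma graddiff_event : exists E : set Omega, [/\ measurable E,
  (P E >= (1 - expR (- p%:R))%:E)%E &
  forall w lam, E w -> 2 * lambda_max (pop_cov P Zf) / lambda_min (pop_cov P Zr) <= lam ->
    (exists th, is_argmin (graddiff_obj lam ntr Zr Zf S w) th) /\
    forall th, is_argmin (graddiff_obj lam ntr Zr Zf S w) th ->
      norm2 (th - theta_r) <= rate_const * (Num.sqrt (p%:R / ntr%:R)
        + (Num.sqrt (p%:R / Nf%:R) + norm2 (theta_r - theta_f)) / lam)].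
Proof.
have Nr0 : (0 < Nr)%N by exact: leq_trans nN.
have r0 := max_ratio_gt0.
have ratio n : (0 < n)%N -> Num.min ntr%:R Nf%:R <= n%:R :> R ->
    Num.sqrt (p%:R / n%:R) <= max_ratio.
  move=> n1 mn; rewrite -[leRHS]ger0_norm ?(ltW r0) // -sqrtr_sqr.
  apply: ler_wsqrtr; rewrite ler_pdivrMr ?ltr0n //; apply: le_trans pn _.
  by rewrite ler_wpM2l // sqr_ge0.
have ratio_r : Num.sqrt (p%:R / ntr%:R) <= max_ratio by apply: ratio; rewrite // ge_min lexx.
have ratio_f : Num.sqrt (p%:R / Nf%:R) <= max_ratio.
  by apply: ratio; rewrite // ge_min lexx orbT.
pose t n : R := 54 * tail_scale * Num.sqrt (p%:R / n%:R).
have k0 := tail_scale_gt0.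
have t_ge0 n : 0 <= t n.
  by rewrite /t mulr_ge0 ?sqrtr_ge0 // mulr_ge0 // ltW // tail_scale_gt0.
have t_le n : Num.sqrt (p%:R / n%:R) <= max_ratio -> 0 <= t n <= 32 * tail_scale.
  move=> h; rewrite t_ge0 /=.
  have h2 : Num.sqrt (p%:R / n%:R) <= 2^-1 :> R.
    by apply: le_trans h _; rewrite /max_ratio ge_min lexx.
  have : tail_scale * Num.sqrt (p%:R / n%:R) <= tail_scale * 2^-1 by rewrite ler_pM2l.
  by rewrite /t; lra.
have [s [ssize s1 net]] := @quarter_net R p p0.
pose s2 : seq (bool * 'rV[R]_p) := [seq (b, v) | b <- [:: true; false], v <- s].
have s2P b v : v \in s -> (b, v) \in s2.
  by move=> vs; apply/allpairsP; exists (b, v); split => //; case: b.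
have s2Q x : x \in s2 -> norm2 x.2 <= 1 by move=> /allpairsP[y [_ ys ->]] /=; exact: s1.
have s2size : (size s2 <= 2 * 2 ^ (18 * p))%N by rewrite size_allpairs leq_mul2l ssize.
have thr_b := pop_minimizer_bound Nr0 K0 mZr sZr min_r cS0 lrmin.
have thf_b := pop_minimizer_bound Nf0 K0 mZf sZf min_f cS0 lfmin.
have [|Ur [mUr PUr hUr]] := random_subset_deviation (s := s2) (g := g theta_r) (t := t ntr)
   k0 (t_le _ ratio_r) mZr (measurable_g theta_r)
   (fun x i xs => subexponential_g (mZr i) (sZr i) thr_b (s2Q x xs)) n0 nN mS PS
   (mutually_independent_inj (h := omap inl) _ indep) erefl (fun=> erefl).
  by move=> [x|] [y|] //= [->].
have [|Uf [mUf PUf hUf]] := full_sample_deviation (s := s2) (g := g theta_f) (t := t Nf)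
   k0 (t_le _ ratio_f) mZf (measurable_g theta_f)
   (fun x i xs => subexponential_g (mZf i) (sZf i) thf_b (s2Q x xs)) Nf0
   (mutually_independent_inj (h := fun i => Some (inr i)) _ indep).
  by move=> x y [].
pose D := [set w | #|S w| = ntr].
have mD : measurable D by exact: measurable_card_subset.
have PD : P D = 1%E by exact: probability_card_subset.
(* [D] has full probability, and each of the two bad events costs half of [expR (- p%:R)]. *)
exists (D `\` (Ur `|` Uf)); split.
- by apply: measurableD => //; exact: measurableU.
- rewrite EFinB leeBlDr // -PD.
  have mE : measurable (D `\` (Ur `|` Uf)) by apply: measurableD => //; exact: measurableU.
  apply: le_trans (_ : P ((D `\` (Ur `|` Uf)) `|` (Ur `|` Uf)) <= _)%E.
    apply: le_measure; [exact/mem_set | |].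
      by apply/mem_set/measurableU => //; exact: measurableU.
    by move=> w Dw; case: (pselect ((Ur `|` Uf) w)) => h; [right | left].
  have h1 := measureU2 P mE (measurableU _ _ mUr mUf); apply: le_trans h1 _.
  apply: leeD => //; have h2 := measureU2 P mUr mUf; apply: le_trans h2 _.
  have -> : expR (- p%:R) = expR (- p%:R) / 2 + expR (- p%:R) / 2 :> R by field.
  rewrite EFinD; apply: leeD.
    by apply: le_trans PUr _; rewrite lee_fin; apply: net_tail_le s2size.
  by apply: le_trans PUf _; rewrite lee_fin; apply: net_tail_le s2size.
move=> w lam [Dw nU] lamg.
have nUr : ~ Ur w by move=> h; apply: nU; left.
have nUf : ~ Uf w by move=> h; apply: nU; right.
have symr := tr_pop_cov P Zr; have symf := tr_pop_cov P Zf.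
have [cr gr] : (forall u, `|bform (emp_cov ntr (S w) (Zr^~ w) - pop_cov P Zr) u u|
      <= 2 * t ntr * dotv u u) /\
    norm2 (emp_score ntr (S w) (Zr^~ w) theta_r) <= 2 * t ntr.
  apply: (net_to_sample symr (t_ge0 _) s1 net) => v vs.
    have -> : bform (pop_cov P Zr) v v =
        Nr%:R^-1 * \sum_i fine 'E_P[fun w => g theta_r (true, v) (Zr i w)].
      rewrite (bform_pop_cov K0 mZr sZr); congr (_ * _); apply: eq_bigr => i _.
      by congr (fine (expectation P _)); apply/funext => w'; rewrite /g /= !lin_form0.
    exact: hUr (true, v) w (s2P true v vs) Dw nUr.
  have := hUr (false, v) w (s2P false v vs) Dw nUr.
  (* The score is centred because [theta_r] minimizes the population loss. *)
  by rewrite [X in _ - _ * X](pop_gradient0 K0 mZr sZr min_r) mulr0 subr0.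
have [cf gf] : (forall u, `|bform (emp_cov Nf [set: 'I_Nf]%SET (Zf^~ w) - pop_cov P Zf) u u|
      <= 2 * t Nf * dotv u u) /\
    norm2 (emp_score Nf [set: 'I_Nf]%SET (Zf^~ w) theta_f) <= 2 * t Nf.
  have sumT (F : 'I_Nf -> R) : \sum_(i in [set: 'I_Nf]%SET) F i = \sum_i F i.
    by apply: eq_bigl => i; rewrite finset.in_setT.
  apply: (net_to_sample symf (t_ge0 _) s1 net) => v vs; rewrite sumT.
    have -> : bform (pop_cov P Zf) v v =
        Nf%:R^-1 * \sum_i fine 'E_P[fun w => g theta_f (true, v) (Zf i w)].
      rewrite (bform_pop_cov K0 mZf sZf); congr (_ * _); apply: eq_bigr => i _.
      by congr (fine (expectation P _)); apply/funext => w'; rewrite /g /= !lin_form0.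
    exact: hUf (true, v) w (s2P true v vs) nUf.
  have := hUf (false, v) w (s2P false v vs) nUf.
  by rewrite [X in _ - _ * X](pop_gradient0 K0 mZf sZf min_f) mulr0 subr0.
pose tau := 108 * tail_scale * max_ratio.
have tau0 : 0 <= tau.
  by rewrite /tau mulr_ge0 ?(ltW r0) // mulr_ge0 // (ltW k0).
have t2 n : Num.sqrt (p%:R / n%:R) <= max_ratio -> 2 * t n <= tau.
  by move=> h; have := ler_wpM2l (ltW k0) h; rewrite /t /tau; lra.
have tauc : 6 * cS ^+ 3 * tau <= 1.
  have c0 := ratio_denominator_gt0.
  have : max_ratio <= (648 * tail_scale * cS ^+ 3)^-1 by rewrite /max_ratio ge_min lexx orbT.
  rewrite -(ler_pM2l c0) mulfV ?gt_eqF //; apply: le_trans.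
  by rewrite /tau le_eqVlt; apply/orP; left; apply/eqP; ring.
have lr1 := lambda_min_le_max p0 symr; have lf1 := lambda_min_le_max p0 symf.
have lrb : cS^-1 <= lambda_min (pop_cov P Zr) <= cS by rewrite lrmin (le_trans lr1 lrmax).
have lfb : cS^-1 <= lambda_max (pop_cov P Zf) <= cS by rewrite (le_trans lfmin lf1) lfmax.
have [ex bd] := @graddiff_deterministic R p Nr Nf (Zr^~ w) (Zf^~ w) (S w) ntr
  (pop_cov P Zr) (pop_cov P Zf) theta_r theta_f cS _ _ tau (2 * t ntr) (2 * t Nf) lam
  cS1 lrb lfb tauc tau0 lamg
  (fun u => lambda_min_le_bform u symr) (fun u => bform_le_lambda_max u symf)
  (fun u => le_trans (cr u) (ler_wpM2r (dotv_ge0 u) (t2 _ ratio_r)))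
  (fun u => le_trans (cf u) (ler_wpM2r (dotv_ge0 u) (t2 _ ratio_f))) gr gf.
split => // th /bd h; apply: le_trans h _.
have lam0 : 0 < lam.
  have ci : 0 < cS^-1 by rewrite invr_gt0.
  case/andP: lrb => lrb _; case/andP: lfb => lfb _.
  apply: lt_le_trans lamg; apply: divr_gt0; last exact: lt_le_trans ci lrb.
  exact: mulr_gt0 (ltr0Sn R 1) (lt_le_trans ci lfb).
rewrite /rate_const -!(mulrA 8) -!(mulrA cS) !(ler_pM2l _) //.
set a := Num.sqrt (p%:R / ntr%:R); set b := Num.sqrt (p%:R / Nf%:R).
set dl := norm2 (theta_r - theta_f).
have a0 : 0 <= a by exact: sqrtr_ge0.
have b0 : 0 <= b / lam by rewrite divr_ge0 ?sqrtr_ge0 // ltW.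
have d0 : 0 <= dl / lam by rewrite divr_ge0 ?norm2_ge0 // ltW.
have c1 : 0 <= cS + 1 := addr_ge0 (ltW cS0) ler01.
have q1 : 0 <= (cS + 1) * a := mulr_ge0 c1 a0.
have q2 : 0 <= (cS + 1) * (b / lam) := mulr_ge0 c1 b0.
have q3 : 0 <= 108 * tail_scale * (dl / lam) := mulr_ge0 (mulr_ge0 (ler0n _ _) (ltW k0)) d0.
rewrite /t -/a -/b -subr_ge0.
have -> : (108 * tail_scale + cS + 1) * (a + (b + dl) / lam) - (2 * (54 * tail_scale * a)
   + (2 * (54 * tail_scale * b) + (cS + 1) * dl) / lam) =
   (cS + 1) * a + (cS + 1) * (b / lam) + 108 * tail_scale * (dl / lam).
  by field; rewrite gt_eqF.
by rewrite !addr_ge0.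
Qed.

End Assembly.

Theorem theorem7 (R : realType) (cSigma K c : R) :
  1 < cSigma -> 0 < K -> 0 <= c < 1 ->
  exists c1 c2 c3 eps0 : R, 0 < c1 /\ 0 < c2 /\ 0 < c3 /\ 0 < eps0 /\
  forall (p Nr Nf ntr : nat) (d : measure_display) (Omega : measurableType d)
    (P : probability Omega R)
    (Zr : 'I_Nr -> Omega -> p.+1.-tuple R)
    (Zf : 'I_Nf -> Omega -> p.+1.-tuple R)
    (S : Omega -> {set 'I_Nr})
    (theta_r theta_f : 'rV[R]_p),
    (* sample sizes *)
    (0 < ntr)%N -> (ntr <= Nr)%N -> (0 < Nf)%N ->
    Nf%:R / (Nr + Nf)%:R <= c ->
    (* p = o(min{ntr, Nf}) *)
    p%:R <= eps0 * Num.min ntr%:R Nf%:R ->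
    (* measurability and mutual independence of all samples and of the subsample *)
    (forall i, measurable_fun setT (Zr i)) ->
    (forall i, measurable_fun setT (Zf i)) ->
    (forall B : set {set 'I_Nr}, measurable (S @^-1` B)) ->
    mutually_independent P
      (fun o : option ('I_Nr + 'I_Nf) => match o with
        | None => gen_events_discrete S
        | Some (inl i) => gen_events (Zr i)
        | Some (inr i) => gen_events (Zf i) end) ->
    (* the subsample is a uniformly random subset of size ntr *)
    (forall A : {set 'I_Nr}, #|A| = ntr ->
       P [set w | S w = A] = (('C(Nr, ntr))%:R^-1)%:E) ->
    (* Condition (C1) *)
    (forall i, subgaussian_vec P (Zr i) K) ->
    (forall i, subgaussian_vec P (Zf i) K) ->
    (forall i k, ('E_P[fun w => tnth (Zf i w) k] = 0)%E) ->
    cSigma^-1 <= lambda_min (pop_cov P Zr) ->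
    lambda_max (pop_cov P Zr) <= cSigma ->
    cSigma^-1 <= lambda_min (pop_cov P Zf) ->
    lambda_max (pop_cov P Zf) <= cSigma ->
    (* population parameters *)
    (forall theta, (pop_loss P Zr theta_r <= pop_loss P Zr theta)%E) ->
    (forall theta, (pop_loss P Zf theta_f <= pop_loss P Zf theta)%E) ->
    let delta := norm2 (theta_r - theta_f) in
    let thr := 2 * lambda_max (pop_cov P Zf) / lambda_min (pop_cov P Zr) in
    let good (lam bound : R) : set Omega :=
      [set w | (exists th, is_argmin (graddiff_obj lam ntr Zr Zf S w) th) /\
               forall th, is_argmin (graddiff_obj lam ntr Zr Zf S w) th ->
                 norm2 (th - theta_r) <= bound] in
    (forall lam : R, thr <= lam ->
       exists E : set Omega, measurable E /\
         E `<=` good lam (c2 * (Num.sqrt (p%:R / ntr%:R)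
                 + (Num.sqrt (p%:R / Nf%:R) + delta) / lam)) /\
         (P E >= (1 - expR (- (c1 * p%:R)))%:E)%E) /\
    (let omega_f := Nf%:R / (Nr + Nf)%:R in
     let omega_r_tilde := ntr%:R / Nr%:R in
     let lam := Num.max (Num.sqrt (omega_r_tilde / omega_f)
                         + Num.sqrt (ntr%:R / p%:R) * delta) thr in
     exists E : set Omega, measurable E /\
       E `<=` good lam (c3 * Num.sqrt (p%:R / ntr%:R)) /\
       (P E >= (1 - expR (- (c1 * p%:R)))%:E)%E).
Proof.
move=> cS1 K0 _; have cS0 : 0 < cSigma := lt_trans ltr01 cS1.
have k0 := tail_scale_gt0 cS1 K0.
have rc0 : 0 < rate_const cSigma K.
  by rewrite /rate_const !mulr_gt0 // !addr_gt0 // mulr_gt0.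
have mr0 := max_ratio_gt0 cS1 K0.
(* [max_ratio] limits a square root, hence the square; the factor [2] arises because in the second
   claim both terms of the first bound are at most [sqrt (p / ntr)]. *)
exists 1, (rate_const cSigma K), (2 * rate_const cSigma K), (max_ratio cSigma K ^+ 2).
split => //; split => //; split; first by rewrite mulr_gt0.
split; first by rewrite exprn_gt0.
move=> p Nr Nf ntr d Omega P Zr Zf S theta_r theta_f n0 nN Nf0 _ pn mZr mZf mS indep PS
  sZr sZf _ lrmin lrmax lfmin lfmax min_r min_f delta thr good.
(* For [p = 0] the required probability is [1 - expR 0 = 0], and the empty event suffices. *)
have [p0|p0] := posnP p.
  have trivial_event (G : set Omega) : exists E : set Omega, measurable E /\ E `<=` G /\
      (P E >= (1 - expR (- (1 * p%:R)))%:E)%E.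
    by exists set0; split => //; split => //; rewrite measure0 p0 mulr0 oppr0 expR0 subrr.
  by split => [lam _|]; exact: trivial_event.
have [E [mE PE goodE]] := graddiff_event cS1 K0 p0 n0 nN Nf0 pn mZr mZf mS indep PS
  sZr sZf lrmin lrmax lfmin lfmax min_r min_f.
rewrite !mul1r; split => [lam lamg|omega_f omega_r_tilde lam].
  by exists E; split => //; split => // w Ew; exact: goodE.
exists E; split => //; split => // w Ew.
have lamg : thr <= lam by rewrite /lam le_max lexx orbT.
have [ex bd] := goodE w lam Ew lamg.
split => // th /bd h; apply: le_trans h _.
have pp : 0 < p%:R :> R by rewrite ltr0n.
have np : 0 < ntr%:R :> R by rewrite ltr0n.
have Nfp : 0 < Nf%:R :> R by rewrite ltr0n.
have Nrp : 0 < Nr%:R :> R by rewrite ltr0n (leq_trans n0).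
set a := Num.sqrt (p%:R / ntr%:R); set b := Num.sqrt (p%:R / Nf%:R).
pose q := Num.sqrt (omega_r_tilde / omega_f).
have q0 : 0 < q by rewrite sqrtr_gt0 !divr_gt0 // natrD addr_gt0.
(* Since [omega_f] is relative to [Nr + Nf], [(a * q) ^+ 2 = p / Nf + p / Nr]. *)
have ba : b <= a * q.
  rewrite /a /q -sqrtrM ?divr_ge0 ?ler0n //; apply: ler_wsqrtr.
  rewrite /omega_r_tilde /omega_f natrD.
  have -> : p%:R / ntr%:R * (ntr%:R / Nr%:R / (Nf%:R / (Nr%:R + Nf%:R))) =
      p%:R / Nf%:R + p%:R / Nr%:R :> R.
    by field; rewrite !gt_eqF // addr_gt0.
  by rewrite lerDl divr_ge0 // ler0n.
have an : a * Num.sqrt (ntr%:R / p%:R) = 1.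
  rewrite /a -sqrtrM ?divr_ge0 ?ler0n // -[RHS]sqrtr1; congr Num.sqrt.
  by field; rewrite !gt_eqF.
have a0 : 0 <= a by exact: sqrtr_ge0.
have laml : q + Num.sqrt (ntr%:R / p%:R) * delta <= lam by rewrite /lam le_max lexx.
have d0 : 0 <= delta by exact: norm2_ge0.
have lam0 : 0 < lam.
  by apply: lt_le_trans laml; rewrite ltr_pwDl // mulr_ge0 // sqrtr_ge0.
(* The two summands in the choice of [lam], multiplied by [a], dominate [b] and [delta]
   respectively. *)
have bd1 : (b + delta) / lam <= a.
  rewrite ler_pdivrMr //; apply: le_trans (ler_wpM2l a0 laml).
  by rewrite mulrDr mulrA an mul1r lerD2r.
rewrite -mulrA [leRHS]mulrCA ler_pM2l // -/delta; lra.
Qed.
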